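(* Let $d\ge 1$ be an integer and let $0<\kappa<1$. Let $\mathbf{F}_\kappa$ be the set of all locally Lipschitz functions $X:\mathbb{R}^2\to\mathbb{R}^d$, $(t,s)\mapsto X(t,s)$, with $X(0,0)=0$, which satisfy the linear wave equation $$\partial_{tt}X=\kappa^2\,\partial_{ss}X\quad\text{on }\mathbb{R}^2$$ together with the constraints $$\kappa\,\partial_tX\cdot\partial_sX=0,\qquad |\partial_tX|^2+\kappa^2|\partial_sX|^2=1-\kappa^2$$ at time $t=0$. Then $\mathbf{F}_\kappa$ is a relatively compact subset of $C^0(\mathbb{R}^2;\mathbb{R}^d)$, and its closure in $C^0(\mathbb{R}^2;\mathbb{R}^d)$ is the set of all locally Lipschitz functions $X:\mathbb{R}^2\to\mathbb{R}^d$ with $X(0,0)=0$ satisfying $$\partial_{tt}X=\kappa^2\,\partial_{ss}X\quad\text{on }\mathbb{R}^2$$ and $$|\partial_tX|^2+\kappa^2|\partial_sX|^2+2\kappa\,|\partial_tX\cdot\partial_sX|\le 1-\kappa^2 .$$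
   Context: $C^0(\mathbb{R}^2;\mathbb{R}^d)$ carries the topology of uniform convergence on compact subsets of $\mathbb{R}^2$. The dot denotes the Euclidean inner product of $\mathbb{R}^d$ and $|\cdot|$ the Euclidean norm. The wave equation is understood in the sense of distributions. A locally Lipschitz solution has the form $X(t,s)=F(s+\kappa t)+G(s-\kappa t)$ with $F,G$ locally Lipschitz, so $\partial_tX(0,s)$ and $\partial_sX(0,s)$ exist for almost every $s\in\mathbb{R}$; the constraints at $t=0$ are required for almost every $s\in\mathbb{R}$. The inequality constraint is required for almost every $(t,s)\in\mathbb{R}^2$. *)

(* Defs.v *)
From HB Require Import structures.
From mathcomp Require Import all_boot all_order all_algebra.
From mathcomp Require Import all_classical all_reals all_analysis.

Set Implicit Arguments.
Unset Strict Implicit.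
Unset Printing Implicit Defensive.

Import Order.TTheory GRing.Theory Num.Theory.
Import numFieldNormedType.Exports.

Local Open Scope classical_set_scope.
Local Open Scope ring_scope.

(* Points of R^2 are pairs (t, s); the maximum norm that the library puts on
   'rV[R]_d and on R * R only serves for topological notions and for local
   Lipschitz continuity, which do not depend on the choice of the norm. *)

Definition dotv (R : realType) (d : nat) (u v : 'rV[R]_d) : R :=
  \sum_(i < d) u ord0 i * v ord0 i.

Definition enorm (R : realType) (d : nat) (u : 'rV[R]_d) : R :=
  Num.sqrt (dotv u u).

Definition et (R : realType) : R * R := (1, 0).
Definition es (R : realType) : R * R := (0, 1).

Definition dt (R : realType) (V : normedModType R) (f : R * R -> V) : R * R -> V :=
  'D_(@et R) f.
Definition ds (R : realType) (V : normedModType R) (f : R * R -> V) : R * R -> V :=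
  'D_(@es R) f.

Definition has_partials (R : realType) (V : normedModType R) (f : R * R -> V)
    (p : R * R) : Prop :=
  derivable f p (@et R) /\ derivable f p (@es R).

(* The iterated partial derivative along the word w: dt for every true and ds
   for every false. *)
Definition iter_partial (R : realType) (w : seq bool) (phi : R * R -> R) :
    R * R -> R :=
  foldr (fun (b : bool) f => if b then dt f else ds f) phi w.

Definition smooth (R : realType) (phi : R * R -> R) : Prop :=
  forall w : seq bool,
    continuous (iter_partial w phi) /\
    forall p, has_partials (iter_partial w phi) p.

Definition test_function (R : realType) (phi : R * R -> R) : Prop :=
  smooth phi /\ compact (closure [set p | phi p != 0]).

Definition leb2 (R : realType) :=
  (@lebesgue_measure R \x @lebesgue_measure R)%E.

(* d_tt X = kappa^2 d_ss X in the sense of distributions: both derivatives are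
   transferred to the test function, component by component. *)
Definition wave_equation (R : realType) (d : nat) (kappa : R)
    (X : R * R -> 'rV[R]_d) : Prop :=
  forall (phi : R * R -> R) (i : 'I_d), test_function phi ->
    \int[@leb2 R]_p (X p ord0 i * dt (dt phi) p) =
    kappa ^+ 2 * \int[@leb2 R]_p (X p ord0 i * ds (ds phi) p).

Definition locally_lipschitz (R : realType) (d : nat)
    (X : R * R -> 'rV[R]_d) : Prop :=
  forall p : R * R, exists2 U, nbhs p U & [lipschitz X q | q in U].

Definition initial_constraints (R : realType) (d : nat) (kappa : R)
    (X : R * R -> 'rV[R]_d) : Prop :=
  {ae @lebesgue_measure R, forall s : R,
    [/\ has_partials X (0, s),
        kappa * dotv (dt X (0, s)) (ds X (0, s)) = 0 &
        enorm (dt X (0, s)) ^+ 2 + kappa ^+ 2 * enorm (ds X (0, s)) ^+ 2 =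
          1 - kappa ^+ 2]}.

Definition relaxed_constraint (R : realType) (d : nat) (kappa : R)
    (X : R * R -> 'rV[R]_d) : Prop :=
  {ae @leb2 R, forall p : R * R,
    has_partials X p /\
    enorm (dt X p) ^+ 2 + kappa ^+ 2 * enorm (ds X p) ^+ 2 +
      2 * kappa * `|dotv (dt X p) (ds X p)| <= 1 - kappa ^+ 2}.

(* The topology of uniform convergence on compact sets is the one that
   {family compact, _ -> _} induces on the continuous maps. A locally Lipschitz
   map is continuous, so sets of such maps may be taken as subsets of C0. *)
Definition C0 (R : realType) (d : nat) : topologicalType :=
  initial_topology
    (id : continuousType (R * R)%type 'rV[R]_d ->
          {family compact, (R * R)%type -> 'rV[R]_d}).

Definition C0_fun (R : realType) (d : nat) (X : C0 R d) : R * R -> 'rV[R]_d :=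
  (X : continuousType (R * R)%type 'rV[R]_d).

Definition F_set (R : realType) (d : nat) (kappa : R) :
    set (C0 R d) :=
  [set X : C0 R d |
    [/\ locally_lipschitz (C0_fun X), C0_fun X (0, 0) = 0,
        wave_equation kappa (C0_fun X) &
        initial_constraints kappa (C0_fun X)]].
Arguments F_set {R} d kappa.

(* Main.v *)
(* In the characteristic coordinates a = s + kappa t, b = s - kappa t the wave
   equation says that the mixed difference of X over every coordinate rectangle
   vanishes, so X = F(a) + G(b). Tested against products of bumps and of smooth
   steps, its distributional form yields exactly this identity for continuous X.
   With dt X = kappa (F' - G') and ds X = F' + G', the relaxed constraint becomes
   |F'| <= c and |G'| <= c and the constraints at t = 0 become |F'| = |G'| = c,
   where c = sqrt (1 - kappa^2) / (2 kappa). Hence the relaxed set consists of the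
   sums of two c-Lipschitz curves through the origin; it is equi-Lipschitz and
   closed, so compact by Arzela-Ascoli. Any c-Lipschitz curve is a uniform limit
   of curves that agree with it on a fine grid and run back and forth at speed
   exactly c in between, so F_kappa is dense in it. *)

From HB Require Import structures.
Require Import Defs.
From mathcomp Require Import all_boot all_order all_algebra.
From mathcomp Require Import all_classical all_reals all_analysis.
From mathcomp Require Import measurable_realfun ring lra.
Set Implicit Arguments.
Unset Strict Implicit.
Unset Printing Implicit Defensive.
Import Order.TTheory GRing.Theory Num.Theory.
Import numFieldNormedType.Exports.
Local Open Scope classical_set_scope.
Local Open Scope ring_scope.

(** * Translations of Lebesgue measure *)

Section Translation.
Context {R : realType}.
Notation mu := (@lebesgue_measure R).

(** The two directions of the distributional equation need different arguments. From the equation to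
    the identity, a product test function reduces the wave operator to a product of first
    derivatives, and continuity of X lets small bumps detect a nonzero mixed difference. Conversely,
    F and G cannot be differentiated twice: second difference quotients of the test function are
    moved onto X by translation invariance, and there the identity equates both sides before any
    limit is taken. Translations are thus the only planar changes of variables. Passing from
    derivatives to Lipschitz constants rests on absolute continuity: a bound on the derivative
    almost everywhere controls increments only because a Lipschitz function is the integral of its
    derivative. A locally Lipschitz X first yields curves whose constants depend on the interval;
    the constraints improve them to the single constant c, and this uniformity gives compactness. *)

Lemma measurable_shift (a : R) :
  measurable_fun setT (fun x : measurableTypeR R => (x + a : measurableTypeR R)).
Proof. exact: (@measurable_funD _ _ _ setT id (cst a)). Qed.

#[global] Instance lebesgue_ae_filter : Filter (almost_everywhere mu).
Proof. exact: ae_filter_ringOfSetsType. Qed.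

Lemma lebesgue_measure_shift (a : R) (A : set R) : measurable A ->
  mu ((fun x => x + a) @^-1` A) = mu A.
Proof.
move=> mA.
rewrite -[LHS]/(pushforward mu
  (fun x : measurableTypeR R => (x + a : measurableTypeR R)) A).
apply/esym/lebesgue_measure_unique => //=; first exact: measurable_shift.
move=> _ _ [[u v]] _ <-; rewrite /pushforward.
rewrite [X in _ = mu X](_ : _ = `]u - a, v - a]%classic); last first.
  by apply/seteqP; split => x /=; rewrite !in_itv /= ltrBlDr lerBrDr.
rewrite !lebesgue_measure_itv /= !lte_fin ltrD2r.
by case: ifP => // _; rewrite -!EFinB; congr EFin; lra.
Qed.

Lemma negligible_shift (a : R) (A : set R) : mu.-negligible A ->
  mu.-negligible ((fun x => x + a) @^-1` A).
Proof.
move=> [B [mB B0 AB]]; exists ((fun x => x + a) @^-1` B); split => //.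
- by rewrite -[_ @^-1` _]setTI; exact: (measurable_shift a measurableT).
- by rewrite -B0; exact: lebesgue_measure_shift.
- by move=> x; exact: AB.
Qed.
End Translation.

(** * Stieltjes measures with bounded density *)

Lemma ls_measure_itvoc (R : realType) (g : cumulative R R) (a b : R) : a <= b ->
  lebesgue_stieltjes_measure g `]a, b]%classic = (g b - g a)%:E.
Proof.
move=> ab; rewrite /lebesgue_stieltjes_measure /measure_extension.
by rewrite measurable_mu_extE/= ?wlength_itv_bnd//; exact: is_ocitv.
Qed.

(* The Stieltjes measures of g and of id - g add up to Lebesgue measure, so the
   former is absolutely continuous and Radon-Nikodym applies. *)
Lemma increment_density (R : realType) (g : R -> R) (a b : R) : a < b ->
  {homo g : x y / x <= y} -> {homo (fun x => x - g x) : x y / x <= y} ->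
  exists f : R -> \bar R,
   [/\ forall x, (0 <= f x)%E, forall x, f x \is a fin_num, (@lebesgue_measure R).-integrable setT f &
    forall x, a <= x -> x <= b ->
      ((g x - g a)%:E = \int[@lebesgue_measure R]_(t in `]a, x]) f t)%E ].
Proof.
move=> ab gnd hnd.
pose h x := x - g x.
have gl x y : x <= y -> g x <= g y <= g x + (y - x).
  move=> xy; rewrite gnd//=; have := hnd _ _ xy => /=; lra.
have hl x y : x <= y -> h x <= h y <= h x + (y - x).
  move=> xy; rewrite hnd//=; have := gnd _ _ xy => /=; rewrite /h; lra.
(* Increments of [g] and [h] lie between 0 and the length of the interval, which yields the right
   continuity that a Stieltjes measure requires. *)
have rc (k : R -> R) : (forall x y, x <= y -> k x <= k y <= k x + (y - x)) -> right_continuous k.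
  move=> kl x; apply/cvgrPdist_lt => e e0.
  near=> t.
  have xt : x < t by near: t; exact: nbhs_right_gt.
  have te : t < x + e by near: t; apply: nbhs_right_lt; rewrite ltrDl.
  have := kl _ _ (ltW xt).
  rewrite distrC => /andP[k1 k2]; rewrite ger0_norm; lra.
pose gC := isCumulative.Build R _ R g gnd (rc g gl).
pose hC := isCumulative.Build R _ R h hnd (rc h hl).
pose gc : cumulative R R := HB.pack g gC.
pose hc : cumulative R R := HB.pack h hC.
pose nug : {measure set (measurableTypeR R) -> \bar R} := lebesgue_stieltjes_measure gc.
pose nuh : {measure set (measurableTypeR R) -> \bar R} := lebesgue_stieltjes_measure hc.
have nugE u v : u <= v -> nug `]u, v]%classic = (g v - g u)%:E by exact: ls_measure_itvoc.
have nuhE u v : u <= v -> nuh `]u, v]%classic = (h v - h u)%:E by exact: ls_measure_itvoc.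
have gle (A : set (measurableTypeR R)) : measurable A -> (nug A <= lebesgue_measure A)%E.
  move=> mA.
  rewrite (@lebesgue_measure_unique R (measure_add nug nuh))//.
    rewrite [leRHS](_ : _ = nug A + nuh A)%E ?leeDl//.
    exact: measure_addE.
  move=> X /ocitvP[->|[[u v] /= uv ->]]; first by rewrite !measure0.
  rewrite [RHS](_ : _ = nug `]u, v]%classic + nuh `]u, v]%classic)%E; last exact: measure_addE.
  rewrite nugE ?nuhE ?(ltW uv)//.
  by rewrite lebesgue_measure_itv/= lte_fin uv /gc /hc /h/= -EFinB -EFinD; congr EFin; lra.
have mab : measurable (`]a, b]%classic : set (measurableTypeR R)) by exact: measurable_itv.
have nufin : (nug `]a, b]%classic < +oo)%E by rewrite nugE ?ltry// ltW.
(* Restricting to []a, b]] makes the measure finite, hence the density integrable; the formula is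
   accordingly claimed for [x] in [a, b] only. *)
pose nu : {finite_measure set (measurableTypeR R) -> \bar R} := mfrestr mab nufin.
have dom : nu `<< (@lebesgue_measure R).
  apply/null_content_dominatesP => A mA A0.
  have mAI : measurable (A `&` `]a, b]%classic : set (measurableTypeR R)) by exact: measurableI.
  apply/eqP; rewrite eq_le measure_ge0 andbT.
  rewrite /nu /mfrestr /mrestr /= (le_trans (gle _ mAI))//= -A0.
  by apply: le_measure; rewrite ?inE//.
have [f [f0 ffin fint fE]] := radon_nikodym_sigma_finite dom.
exists f; split => // x ax xb.
rewrite -fE; last exact: measurable_itv.
rewrite /nu /= /mfrestr /mrestr (_ : _ `&` _ = `]a, x]%classic).
  exact/esym/nugE.
apply/seteqP; split => t /=; rewrite !in_itv /=; first by case.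
by move=> /andP[-> tx]; rewrite tx (le_trans tx xb).
Unshelve. all: by end_near. Qed.

(** * Lipschitz functions of one variable *)

Section Lipschitz.
Context {R : realType}.
Notation mu := (@lebesgue_measure R).
Implicit Types (f g : R -> R) (a b c L : R).

(** The density is a version of the derivative: its indefinite integral is derivable almost
    everywhere by Lebesgue differentiation, and near an interior point of [a, b] it differs from [g]
    by a constant. *)
Lemma increment_ae g a b : a < b ->
  {homo g : x y / x <= y} -> {homo (fun x => x - g x) : x y / x <= y} ->
  exists f : R -> R,
   [/\ forall x, 0 <= f x, mu.-integrable setT (EFin \o f),
    forall x, a <= x -> x <= b -> g x - g a = \int[mu]_(t in `]a, x]) f t &
    {ae mu, forall x, a < x < b -> derivable g x 1 /\ 'D_1 g x = f x} ].
Proof.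
move=> ab gnd hnd; have [f [f0 ffin fint fE]] := @increment_density _ _ _ _ ab gnd hnd.
pose k := fine \o f.
have kE : EFin \o k = f by apply/funext => x /=; rewrite fineK.
have kint : mu.-integrable setT (EFin \o k) by rewrite kE.
have gE x : a <= x -> x <= b -> g x - g a = \int[mu]_(t in `]a, x]) k t.
  move=> ax xb; have /(congr1 fine) /= -> := fE x ax xb.
  by congr fine; apply: eq_integral => t _; rewrite -kE.
exists k; split => //; first by move=> x; apply/fine_ge0/f0.
have kint' y : mu.-integrable [set` Interval (BRight a) (BRight y)] (EFin \o k).
  exact: integrableS kint.
have := FTC1 kint' (open_integrable_locally openT kint).
apply: filterS => x /= + /andP[ax xb].
rewrite lte_fin => /(_ ax)[dF]; rewrite derive1E => FE.
pose F y := \int[mu]_(t in `]a, y]) k t.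
have FgE : \forall y \near x, F y + g a = g y.
  near=> y; rewrite /F -gE; first by rewrite subrK.
    by apply/ltW; near: y; exact: lt_nbhsr.
  by apply/ltW; near: y; exact: lt_nbhsl.
have dg : is_derive x 1 g (k x).
  apply: (near_eq_is_derive (f := fun y => F y + g a)).
  - exact: FgE.
  - by rewrite -[X in is_derive _ _ _ X]addr0; apply: is_deriveD; exact: DeriveDef.
by have [] := dg.
Unshelve. all: by end_near. Qed.

(** Normalization for [increment_ae]: [g / L] has slopes in [-1, 1], so its average with the
    identity has slopes in [0, 1]. *)
Lemma monotone_lip g L : 0 < L -> (forall x y, `|g x - g y| <= L * `|x - y|) ->
  let k x := (g x / L + x) / 2 in
  {homo k : x y / x <= y} /\ {homo (fun x => x - k x) : x y / x <= y}.
Proof.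
move=> L0 gl k; have gl' x y : x <= y -> `|g y / L - g x / L| <= y - x.
  move=> xy; rewrite -mulrBl normrM (gtr0_norm (x:=L^-1)) ?invr_gt0// ler_pdivrMr// mulrC.
  by rewrite (le_trans (gl _ _))// ger0_norm ?subr_ge0.
by split => x y xy; have := gl' _ _ xy; rewrite ler_norml /k; lra.
Qed.

(** Rademacher's theorem on the line. The normalized function is treated on countably many intervals
    that exhaust the line. *)
Lemma lip_ae_derivable f L : (forall x y, `|f x - f y| <= L * `|x - y|) ->
  {ae mu, forall x, derivable f x 1}.
Proof.
move=> fl0.
pose M := `|L| + 1.
have M0 : 0 < M by rewrite /M; have := normr_ge0 L; lra.
have fl x y : `|f x - f y| <= M * `|x - y|.
  rewrite (le_trans (fl0 _ _))// ler_wpM2r// /M; have := ler_norm L; lra.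
have /= [kn hn] := monotone_lip M0 fl.
set k := (fun x : R => (f x / M + x) / 2) in kn hn.
have H (n : nat) : {ae mu, forall x, - (n.+1%:R) < x < n.+1%:R -> derivable k x 1}.
  have [|h [_ _ _]] := @increment_ae k (- n.+1%:R) n.+1%:R _ kn hn.
    by have : 0 < n.+1%:R :> R by []; lra.
  by apply: filterS => x + xn => /(_ xn)[].
have := ae_foralln H; apply: filterS => x Hx.
have kd : derivable k x 1.
  apply: (Hx (Num.bound `|x|)); rewrite -ltr_norml.
  by rewrite (lt_le_trans (archi_boundP _))// ler_nat.
have -> : f = (fun y => M *: (2 *: k y - y)).
  by apply/funext => y; rewrite /k /GRing.scale /=; field; rewrite gt_eqF.
apply: derivableZ; apply: derivableB; last exact: derivable_id.
exact: derivableZ.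
Qed.

(** The mean value theorem is out of reach, since the derivative is controlled only off a null set;
    the increment is instead an integral of the derivative, which ignores null sets. *)
Lemma lip_derive_le f L a b c : (forall x y, `|f x - f y| <= L * `|x - y|) ->
  {ae mu, forall x, derivable f x 1 -> 'D_1 f x <= c} -> a <= b ->
  f b - f a <= c * (b - a).
Proof.
move=> fl0 fc; rewrite le_eqVlt => /predU1P[->|ab]; first by rewrite !subrr mulr0.
pose M := `|L| + 1.
have M0 : 0 < M by rewrite /M; have := normr_ge0 L; lra.
have fl x y : `|f x - f y| <= M * `|x - y|.
  rewrite (le_trans (fl0 _ _))// ler_wpM2r// /M; have := ler_norm L; lra.
have /= [kn hn] := monotone_lip M0 fl.
set k := (fun x : R => (f x / M + x) / 2) in kn hn.
have fE : f = (fun y => M *: (2 *: k y - y)).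
  by apply/funext => y; rewrite /k /GRing.scale /=; field; rewrite gt_eqF.
(* The interval is enlarged so that [b] becomes an interior point. *)
have ab1 : a < b + 1 by lra.
have [h [h0 hint kE hae]] := @increment_ae k a (b + 1) ab1 kn hn.
(* The bound [c] after the affine change from [f] to [k]. *)
pose c' := (c / M + 1) / 2.
have hc : {ae mu, forall x, a < x < b + 1 -> h x <= c'}.
  move: hae fc; apply: filterS2 => x + + xab.
  move=> /(_ xab)[dk dkh] fc.
  have idf : is_derive x 1 f (M *: (2 *: h x - 1)).
    rewrite fE; apply: is_deriveZ; apply: is_deriveB; apply: is_deriveZ.
    exact: DeriveDef.
  have [dfx dfE] := idf; move: (fc dfx).
  rewrite dfE /GRing.scale/= /c' => Hc.
  rewrite ler_pdivlMr// -lerBlDr ler_pdivlMr//; lra.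
have : k b - k a <= c' * (b - a).
  have : ((k b - k a)%:E <= (c' * (b - a))%:E)%E; last by rewrite lee_fin.
  (* Comparing nonnegative integrals needs [0 <= c']. An interval of positive length contains a
     point where the almost sure bound holds, and [h] is nonnegative there. *)
  have c'0 : 0 <= c'.
    have [x [xab hx]] : exists x, a < x < b + 1 /\ h x <= c'.
      apply/not_existsP => Hx; case: hc => A [mA A0 sA].
      have : (mu `]a, (b + 1)%R[%classic <= 0)%E.
        rewrite -A0; apply: le_measure; rewrite ?inE//= => x; rewrite /= in_itv /= => xab.
        by apply: sA => /= /(_ xab) hx; apply: (Hx x).
      by rewrite lebesgue_measure_itv/= lte_fin ab1 -EFinB lee_fin; lra.
    exact: le_trans (h0 x) hx.
  rewrite kE ?(ltW ab)//; last by rewrite lerDl.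
  have -> : (c' * (b - a))%:E = (\int[mu]_(t in `]a, b]) c'%:E)%E.
    by rewrite integral_cst//= lebesgue_measure_itv /= lte_fin ab EFinM.
  have hint' : mu.-integrable `]a, b] (EFin \o h) by exact: integrableS hint.
  rewrite /Rintegral fineK; last exact: integrable_fin_num.
  apply: ae_ge0_le_integral => //.
  - by move=> x _; rewrite lee_fin.
  - by case/integrableP : hint'.
  - move: hc; apply: filterS => x hx /=; rewrite in_itv /= => /andP[ax xb].
    by rewrite lee_fin hx// ax (le_lt_trans xb)// ltrDl.
rewrite /k /c' => Hk.
by rewrite -(ler_pM2r (x := M^-1)) ?invr_gt0//; lra.
Qed.
End Lipschitz.

(** * Smooth bumps *)

Section Bump.
Context {R : realType}.
Implicit Types (x y : R) (n m : nat).

(** The powers of [x^-1] are included so that derivatives stay in the span of the family; [n = 0] is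
    the classical flat function. *)
Definition flat n x : R := if 0 < x then x^-1 ^+ n * expR (- x^-1) else 0.

Lemma exprn_le_expR n y : 0 <= y -> y ^+ n.+1 <= n.+1%:R ^+ n.+1 * expR y.
Proof.
move=> y0; have n0 : 0 < n.+1%:R :> R by [].
rewrite -ler_pdivrMl ?exprn_gt0// mulrC -expr_div_n.
have -> : expR y = expR (y / n.+1%:R) ^+ n.+1.
  by rewrite -expRM_natr divfK// gt_eqF.
rewrite lerXn2r ?nnegrE ?expR_ge0 ?divr_ge0//.
by rewrite (le_trans _ (expR_ge1Dx _))// lerDr.
Qed.

Lemma flat_ge0 n x : 0 <= flat n x.
Proof.
rewrite /flat; case: ifPn => // x0.
by rewrite mulr_ge0 ?expR_ge0 ?exprn_ge0 ?invr_ge0 ?ltW.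
Qed.

Lemma flat_gt0 n x : 0 < x -> 0 < flat n x.
Proof. by move=> x0; rewrite /flat x0 mulr_gt0 ?expR_gt0 ?exprn_gt0 ?invr_gt0. Qed.

Lemma flat_eq0 n x : x <= 0 -> flat n x = 0.
Proof. by rewrite /flat leNgt => /negbTE ->. Qed.

Lemma flat_le n x : flat n.+1 x <= n.+1%:R ^+ n.+1.
Proof.
rewrite /flat; case: ifPn => x0; last exact: exprn_ge0.
rewrite expRN ler_pdivrMr ?expR_gt0//.
by apply: exprn_le_expR; rewrite invr_ge0 ltW.
Qed.

Lemma flatS n x : 0 < x -> x^-1 * flat n x = flat n.+1 x.
Proof. by move=> x0; rewrite /flat x0 mulrA exprS. Qed.

(** Trading one more power of [x^-1] against the exponential shows that the difference quotient at 0
    is of order [x], so the derivative there is 0. *)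
Lemma flat_quot n x : 0 < x -> `|x^-1 * flat n x| <= x * n.+2%:R ^+ n.+2.
Proof.
move=> x0; rewrite flatS// ger0_norm ?flat_ge0//.
rewrite -[flat _ _](@mulVKf _ x) ?gt_eqF// flatS//.
by rewrite ler_pM2l// flat_le.
Qed.

Lemma is_derive_flat n x :
  is_derive x 1 (flat n) (flat n.+2 x - n%:R * flat n.+1 x).
Proof.
have [x0|x0|->] := ltgtP x 0.
- rewrite !flat_eq0 ?(ltW x0)// mulr0 subr0.
  have N : \forall y \near x, cst 0 y = flat n y.
    by near=> y; rewrite flat_eq0//; apply: ltW; near: y; exact: lt_nbhsl.
  exact: near_eq_is_derive N (is_derive_cst _ _ _).
- have N : \forall y \near x, y^-1 ^+ n * expR (- y^-1) = flat n y.
    by near=> y; rewrite /flat ifT//; near: y; exact: lt_nbhsr.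
  apply: near_eq_is_derive N _.
  have dV : is_derive x 1 (fun y : R => y^-1) (- x ^- 2).
    apply: DeriveDef; first by apply: derivableV; rewrite ?gt_eqF.
    by rewrite deriveV ?gt_eqF// derive_id /GRing.scale/= mulr1.
  have dE : is_derive x 1 (fun y : R => expR (- y^-1)) (expR (- x^-1) * - - x ^- 2).
    exact: (is_derive1_comp (f := expR) (g := fun y => - y^-1)).
  have x0' : x != 0 by rewrite gt_eqF.
  have E : (fun y : R => y^-1 ^+ n * expR (- y^-1)) =
      (fun y : R => y^-1) ^+ n * (fun y => expR (- y^-1)).
    by apply/funext => y; rewrite !fctE.
  rewrite E; apply: (is_derive_eq (is_deriveM (is_deriveX n dV) dE)).
  rewrite /flat x0 /GRing.scale/= opprK !fctE.
  by clear -x0'; case: n => [|n]; rewrite ?exprS ?expr0 /=; field.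
- rewrite !flat_eq0// mulr0 subr0.
  have H : h^-1 *: ((flat n \o shift 0) (h *: 1) - flat n 0) @[h --> 0^'] --> (0 : R).
    apply/cvgr0Pnorm_le => e e0; near=> h.
    rewrite /= addr0 [X in _ - X]flat_eq0// subr0 /GRing.scale/= mulr1.
    have [h0|h0] := lerP h 0; first by rewrite flat_eq0// mulr0 normr0 ltW.
    rewrite (le_trans (flat_quot n h0))// -ler_pdivlMr ?exprn_gt0//.
    apply: le_trans (ler_norm _) _; near: h; apply: dnbhs0_le; rewrite divr_gt0 ?exprn_gt0//.
  by apply: DeriveDef; [apply/cvg_ex; exists 0|exact: cvg_lim].
Unshelve. all: by end_near. Qed.

Lemma is_diff_affine (a b c : R) (p : R * R) :
  is_diff p (fun p : R * R => a * p.1 + b * p.2 + c) (fun v => a * v.1 + b * v.2).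
Proof.
have d1 : is_diff p (fst : R * R -> R) fst.
  have c1 : continuous (fst : R * R -> R) by move=> q; exact: cvg_fst.
  by apply: DiffDef; [exact: linear_differentiable|exact: diff_lin].
have d2 : is_diff p (snd : R * R -> R) snd.
  have c1 : continuous (snd : R * R -> R) by move=> q; exact: cvg_snd.
  by apply: DiffDef; [exact: linear_differentiable|exact: diff_lin].
have := is_diffD (is_diffD (is_diffZ a d1) (is_diffZ b d2)) (is_diff_cst c p).
by rewrite addr0.
Qed.

Lemma comp_affine (V : normedModType R) (F : R -> V) (a b c : R) (p : R * R) F' :
  is_derive (a * p.1 + b * p.2 + c) 1 F F' ->
  differentiable (fun q : R * R => F (a * q.1 + b * q.2 + c)) p /\
  forall v, 'D_v (fun q : R * R => F (a * q.1 + b * q.2 + c)) p =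
    (a * v.1 + b * v.2) *: F'.
Proof.
move=> [dF FE]; have [dl lE] := is_diff_affine a b c p.
have dF' := (derivable1_diffP _ _).1 dF.
have dFl := differentiable_comp dl dF'.
split=> // v; rewrite deriveE// (diff_comp dl dF') /= lE.
by rewrite deriv1E//= derive1E FE.
Qed.

(** A syntactic class closed under differentiation: smoothness follows by induction on the
    construction. [sm_prim] admits [step], known only through its derivative. *)
Inductive sm : (R -> R) -> Prop :=
| sm_flat n a b : sm (fun x => flat n (a * x + b))
| sm_add f g : sm f -> sm g -> sm (f + g)
| sm_mul f g : sm f -> sm g -> sm (f * g)
| sm_scale (c : R) f : sm f -> sm (c \*: f)
| sm_prim f f' : (forall x, is_derive x 1 f (f' x)) -> sm f' -> sm f.

Lemma sm_derive f : sm f -> exists2 f', sm f' & forall x, is_derive x 1 f (f' x).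
Proof.
elim => {f} [n a b|f g _ [f' sf' df] _ [g' sg' dg]|f g sf [f' sf' df] sg [g' sg' dg]|c f _ [f' sf' df]|f f' df sf' _].
- exists (a \*: ((fun x => flat n.+2 (a * x + b)) + (- n%:R) \*: (fun x => flat n.+1 (a * x + b)))).
    by do 2![constructor]; [constructor|apply: sm_scale; constructor].
  move=> x.
  have dl : is_derive x 1 (fun x : R => a * x + b) a.
    have := is_deriveD (is_deriveZ a (is_derive_id x 1)) (is_derive_cst b x 1).
    by rewrite /GRing.scale/= mulr1 addr0.
  have H := is_derive1_comp (g := fun x => a * x + b) (is_derive_flat n (a * x + b)) dl.
  by apply: (is_derive_eq H); rewrite !fctE /= /GRing.scale /=; ring.
- exists (f' + g'); first exact: sm_add.
  by move=> x; exact: is_deriveD.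
- exists (f * g' + g * f'); first by apply: sm_add; exact: sm_mul.
  by move=> x; exact: is_deriveM.
- exists (c \*: f'); first exact: sm_scale.
  by move=> x; exact: is_deriveZ.
- by exists f'.
Qed.

Lemma sm_differentiable f x : sm f -> differentiable f x.
Proof. by move=> /sm_derive[f' _ df]; apply/derivable1_diffP; have [] := df x. Qed.

(** The planar counterpart of [sm]; composition with affine forms suffices because test functions
    are built from characteristic coordinates. *)
Inductive sm2 : (R * R -> R) -> Prop :=
| sm2_comp f a b c : sm f -> sm2 (fun p => f (a * p.1 + b * p.2 + c))
| sm2_add f g : sm2 f -> sm2 g -> sm2 (f + g)
| sm2_mul f g : sm2 f -> sm2 g -> sm2 (f * g)
| sm2_scale (c : R) f : sm2 f -> sm2 (c \*: f).

Lemma sm2_differentiable f p : sm2 f -> differentiable f p.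
Proof.
elim => {f} [f a b c sf|f g _ df _ dg|f g _ df _ dg|c f _ df].
- have [f' _ df] := sm_derive sf.
  by have [] := comp_affine (df (a * p.1 + b * p.2 + c)).
- exact: differentiableD.
- exact: differentiableM.
- exact: differentiableZ.
Qed.

Lemma sm2_derive v f : sm2 f -> exists2 f', sm2 f' & forall p, 'D_v f p = f' p.
Proof.
elim => {f} [f a b c sf|f g sf [f' sf' df] sg [g' sg' dg]|f g sf [f' sf' df] sg [g' sg' dg]|c f sf [f' sf' df]].
- have [f' sf' df] := sm_derive sf.
  exists ((a * v.1 + b * v.2) \*: (fun p : R * R => f' (a * p.1 + b * p.2 + c))).
    by apply: sm2_scale; exact: sm2_comp.
  by move=> p; have [_ ->] := comp_affine (df (a * p.1 + b * p.2 + c)).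
- exists (f' + g'); first exact: sm2_add.
  move=> p; rewrite deriveD ?df ?dg//; apply: diff_derivable; exact: sm2_differentiable.
- exists (f * g' + g * f'); first by apply: sm2_add; exact: sm2_mul.
  move=> p; rewrite deriveM ?df ?dg//; apply: diff_derivable; exact: sm2_differentiable.
- exists (c \*: f'); first exact: sm2_scale.
  move=> p; rewrite deriveZ ?df//; apply: diff_derivable; exact: sm2_differentiable.
Qed.

Lemma sm2_smooth f : sm2 f -> smooth f.
Proof.
move=> sf w; suff /sm2_differentiable H : sm2 (iter_partial w f).
  split => [p|p]; first exact/differentiable_continuous/H.
  by split; apply: diff_derivable; exact: H.
elim: w => //= b w IH.
by case: b; [have [f' sf' E] := sm2_derive (@et R) IH|have [f' sf' E] := sm2_derive (@es R) IH];
  [have -> : dt (iter_partial w f) = f' by exact/funext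
  |have -> : ds (iter_partial w f) = f' by exact/funext].
Qed.

(** The factors [1] and [-1] keep the shape demanded by [sm_flat]; each factor cuts off one side of
    the interval from [- e] to [e]. *)
Definition bump (e x : R) : R := flat 0 (1 * x + e) * flat 0 (-1 * x + e).

(** A smoothed, unnormalized Heaviside function; only differences of its translates, which have
    compact support, enter the test functions. *)
Definition step (e x : R) : R := \int[@lebesgue_measure R]_(t in `]-oo, x]) bump e t.

Lemma sm_bump e : sm (bump e).
Proof. by apply: sm_mul; exact: sm_flat. Qed.

Lemma is_derive_step e x : is_derive x 1 (step e) (bump e x).
Proof.
have ce : continuous (bump e).
  by move=> y; apply/differentiable_continuous/sm_differentiable/sm_bump.
have ie : (@lebesgue_measure R).-integrable setT (EFin \o bump e).
  have H : (@lebesgue_measure R).-integrable `[- e, e] (EFin \o bump e).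
    apply: continuous_compact_integrable; first exact: segment_compact.
    exact: continuous_subspaceT.
  rewrite integrable_mkcond//= in H.
  apply: eq_integrable H => // y _.
  rewrite /= patchE; case: ifPn => //; rewrite notin_setE /= in_itv /= => /negP.
  rewrite negb_and -!ltNge => /orP[xe|xe]; congr EFin; rewrite /bump.
    by rewrite flat_eq0 ?mul0r//; lra.
  by rewrite mulrC flat_eq0 ?mul0r//; lra.
have xx1 : x < x + 1 by rewrite ltrDl.
have ie' : (@lebesgue_measure R).-integrable [set` Interval -oo%O (BRight (x + 1))]
    (EFin \o bump e).
  exact: integrableS ie.
have [dF FE] := continuous_FTC1 xx1 ie' (ltNyr x) (ce x).
by rewrite derive1E in FE; exact: (DeriveDef dF FE).
Qed.

Lemma sm_step e : sm (step e).
Proof. by apply: sm_prim (sm_bump e) => x; exact: is_derive_step. Qed.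

Lemma bump_ge0 e x : 0 <= bump e x.
Proof. by rewrite mulr_ge0 ?flat_ge0. Qed.

Lemma bump_gt0 e x : `|x| < e -> 0 < bump e x.
Proof. by rewrite ltr_norml => /andP[? ?]; rewrite mulr_gt0// flat_gt0//; lra. Qed.

Lemma bump_eq0 e x : e <= `|x| -> bump e x = 0.
Proof.
rewrite ler_normr /bump => /orP[xe|xe].
  by rewrite mulrC flat_eq0 ?mul0r//; lra.
by rewrite flat_eq0 ?mul0r//; lra.
Qed.

Lemma step_const e x y : x <= y -> (forall z, x <= z <= y -> e <= `|z|) ->
  step e x = step e y.
Proof.
move=> xy H.
have cs : {within `[x, y], continuous (step e)}.
  apply: continuous_subspaceT => z.
  by apply/differentiable_continuous/sm_differentiable/sm_step.
have [z zxy E] := MVT_segment xy (fun z _ => is_derive_step e z) cs.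
apply/eqP; rewrite eq_sym -subr_eq0 E bump_eq0 ?mul0r//.
by apply: H; move: zxy; rewrite in_itv.
Qed.

End Bump.

(** * Lebesgue measure on the plane *)

Section Plane.
Context {R : realType}.
Notation RR := (measurableTypeR R * measurableTypeR R)%type.
Notation mu2 := (@leb2 R).
Implicit Types (p q : R * R).

Lemma open_measurable2 (U : set (R * R)) : open U -> measurable (U : set RR).
Proof.
move=> oU.
pose Q (a b c d : rat) : set RR :=
  (`]ratr a, ratr b[%classic : set (measurableTypeR R)) `*` (`]ratr c, ratr d[%classic : set (measurableTypeR R)).
(* Rectangles that leave [U] are replaced by the empty set, so that the union can run over all
   rational quadruples. *)
pose B (a b c d : rat) : set RR := if `[< Q a b c d `<=` U >] then Q a b c d else set0.
have -> : U = \bigcup_a \bigcup_b \bigcup_c \bigcup_d B a b c d.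
  apply/seteqP; split => [[x y] Uxy|p [a _ [b _ [c _ [d _]]]]]; last first.
    by rewrite /B; case: ifPn => // /asboolP; apply.
  have [e /= e0 Ue] : exists2 e : R, 0 < e & ball (x, y) e `<=` U.
    by have := oU; rewrite openE => /(_ _ Uxy) /nbhs_ballP.
  have [a /[!in_itv]/= /andP[a1 a2]] := @rat_in_itvoo R (x - e) x ltac:(lra).
  have [b /[!in_itv]/= /andP[b1 b2]] := @rat_in_itvoo R x (x + e) ltac:(lra).
  have [c /[!in_itv]/= /andP[c1 c2]] := @rat_in_itvoo R (y - e) y ltac:(lra).
  have [d /[!in_itv]/= /andP[d1 d2]] := @rat_in_itvoo R y (y + e) ltac:(lra).
  exists a => //; exists b => //; exists c => //; exists d => //.
  rewrite /B ifT; first by split => /=; rewrite in_itv /=; apply/andP.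
  apply/asboolP => -[u v] [] /=; rewrite !in_itv /= => /andP[u1 u2] /andP[v1 v2].
  by apply: Ue; split; rewrite /ball /= ltr_norml; lra.
do 4![apply: bigcupT_measurable_rat => ?].
rewrite /B; case: ifPn => // _; apply: measurableX; exact: measurable_itv.
Qed.

Lemma continuous_measurable2 (f : R * R -> R) : continuous f ->
  measurable_fun setT (f : RR -> R).
Proof.
move=> cf; apply: (measurability _ (RGenOpens.measurableE R)).
move=> _ [_ [a [b ->] <-]]; rewrite setTI; apply: open_measurable2.
by apply: open_comp => // p _; exact: cf.
Qed.

Lemma measurable_shift2 q :
  measurable_fun setT (fun p : RR => (p + q : RR)).
Proof.
by apply: measurable_fun_pair;
  apply: (measurableT_comp (measurable_shift _)); [exact: measurable_fst|exact: measurable_snd].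
Qed.

Lemma leb2_shift q (A : set RR) : measurable A ->
  mu2 ((fun p => p + q) @^-1` A) = mu2 A.
Proof.
move=> mA.
rewrite -[LHS]/(pushforward mu2 (fun p : RR => (p + q : RR)) A).
apply/esym/product_measure_unique => //=; first exact: measurable_shift2.
move=> _ C D mC mD; rewrite /pushforward.
rewrite [X in leb2 X = _](_ : _ = ((fun x => x + q.1) @^-1` C : set (measurableTypeR R)) `*`
  ((fun x => x + q.2) @^-1` D : set (measurableTypeR R)))//.
rewrite /leb2 product_measure1E; first by congr (_ * _)%E; exact: lebesgue_measure_shift.
- by rewrite -[_ @^-1` _]setTI; exact: (measurable_shift _ measurableT).
- by rewrite -[_ @^-1` _]setTI; exact: (measurable_shift _ measurableT).
Qed.

Lemma leb2_integral_shift q (f : RR -> \bar R) : measurable_fun setT f ->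
  (\int[mu2]_p f ((p : R * R) + q)%R = \int[mu2]_p f p)%E.
Proof.
have ge0 (g : RR -> \bar R) : measurable_fun setT g -> (forall p, 0 <= g p)%E ->
    (\int[mu2]_p g ((p : R * R) + q)%R = \int[mu2]_p g p)%E.
  move=> mg g0.
  have := @ge0_integral_pushforward _ _ _ _ R _ (measurable_shift2 q) mu2 setT g measurableT mg (fun y _ => g0 y).
  rewrite preimage_setT => <-.
  apply: eq_measure_integral; first exact: measurable_shift2.
  by move=> m A mA _; exact/leb2_shift.
move=> mf; rewrite [LHS]integralE [RHS]integralE.
congr (_ - _)%E.
- rewrite -(ge0 _ (measurable_funepos mf)); last by move=> p; exact: funepos_ge0.
  by apply: eq_integral => p _; rewrite !funeposE.
- rewrite -(ge0 _ (measurable_funeneg mf)); last by move=> p; exact: funeneg_ge0.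
  by apply: eq_integral => p _; rewrite !funenegE.
Qed.

Lemma leb2_Rintegral_shift q (f : R * R -> R) : continuous f ->
  \int[mu2]_p f (p + q) = \int[mu2]_p f p.
Proof.
move=> cf; congr fine; apply: (leb2_integral_shift q (f := EFin \o f)).
by apply/measurable_EFinP; exact: continuous_measurable2.
Qed.

Definition box (N : R) : set (R * R) := `[- N, N]%classic `*` `[- N, N]%classic.

Lemma leb2_box_fin N : (mu2 (box N) < +oo)%E.
Proof.
rewrite /leb2 /box product_measure1E; [|exact: measurable_itv|exact: measurable_itv].
have fin : (@lebesgue_measure R `[(- N)%R, N]%classic < +oo)%E.
  by rewrite lebesgue_measure_itv /=; case: ifP => _; rewrite ?ltry// -EFinB ltry.
by apply: lte_mul_pinfty => //; rewrite ge0_fin_numE.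
Qed.

Lemma measurable_box N : measurable (box N : set RR).
Proof. by apply: measurableX; exact: measurable_itv. Qed.

Lemma compact_box N : compact (box N : set (R * R)).
Proof. by apply: compact_setX; exact: segment_compact. Qed.

Lemma continuous_box_bounded N (f : R * R -> R) : continuous f ->
  exists M, forall p, box N p -> `|f p| <= M.
Proof.
move=> cf; have /compact_bounded [M [Mr HM]] : compact (f @` (box N : set (R * R))).
  by apply: continuous_compact; [exact: continuous_subspaceT|exact: compact_box].
by exists (M + 1) => p Np; apply: (HM (M + 1)); [rewrite ltrDl|exists p].
Qed.

Lemma box_integrable N (f : R * R -> R) : continuous f ->
  (forall p, ~ box N p -> f p = 0) -> mu2.-integrable setT (EFin \o f).
Proof.
move=> cf f0; have [M HM] := continuous_box_bounded N cf.
have mf := continuous_measurable2 cf.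
have H : mu2.-integrable (box N) (EFin \o f).
  apply: measurable_bounded_integrable.
  - exact: measurable_box.
  - exact: leb2_box_fin.
  - exact: measurable_funTS.
  - exists `|M|; split; first exact: num_real.
    move=> x Mx p /= pN; rewrite (le_trans (HM p pN))// (le_trans (ler_norm _))//.
    exact: ltW.
rewrite integrable_mkcond in H; last exact: measurable_box.
apply: eq_integrable H => // p _.
by rewrite /= patchE; case: ifPn => //; rewrite notin_setE => /f0 ->.
Qed.

End Plane.

(** * Compactly supported integrands *)

Section Support.
Context {R : realType}.
Notation mu2 := (@leb2 R).
Implicit Types (p q v : R * R) (f g h : R * R -> R).

Lemma boxP (N : R) p : box N p <-> `|p.1| <= N /\ `|p.2| <= N.
Proof. by rewrite /box /= !in_itv /= !ler_norml. Qed.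

Lemma closed_box (N : R) : closed (box N : set (R * R)).
Proof. apply: compact_closed; [exact: norm_hausdorff|exact: compact_box]. Qed.

Lemma box_derive N f v p : (forall q, ~ box N q -> f q = 0) -> ~ box N p ->
  'D_v f p = 0.
Proof.
move=> f0 pN.
have oB := closed_openC (@closed_box N).
have nB : nbhs p (~` box N) by exact: open_nbhs_nbhs.
have H : \forall q \near p, cst 0 q = f q by apply: filterS nB => q /f0 ->.
by have [_ ->] := near_eq_is_derive H (is_derive_cst (0 : R) p v).
Qed.

Lemma test_function_box f : test_function f -> exists N, forall p, ~ box N p -> f p = 0.
Proof.
move=> [_ /compact_bounded [M [Mr HM]]].
exists (M + 1) => p; apply: contra_notP => /eqP fp.
have /(HM (M + 1) ltac:(rewrite ltrDl; exact: ltr01)) : closure [set p | f p != 0] p by exact: subset_closure.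
by rewrite boxP /Num.Def.normr /= ge_max => /andP[].
Qed.

(** Continuous functions of compact support, a class that is stable under translation and under
    multiplication by continuous functions and consists of integrable ones. *)
Definition cbox f := continuous f /\ exists N, forall p, ~ box N p -> f p = 0.

Lemma boxW (N M : R) p : N <= M -> box N p -> box M p.
Proof. by move=> NM; rewrite !boxP => -[a b]; split; exact: le_trans NM. Qed.

Lemma cbox_integrable f : cbox f -> mu2.-integrable setT (EFin \o f).
Proof. by move=> [cf [N f0]]; exact: box_integrable f0. Qed.

Lemma cboxD f g : cbox f -> cbox g -> cbox (fun p => f p + g p).
Proof.
move=> [cf [N f0]] [cg [M g0]]; split; first by move=> p; apply: cvgD; [exact: cf|exact: cg].
exists (Num.max N M) => p pNM; rewrite f0 ?g0 ?addr0//; apply: contra_not pNM;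
  apply: boxW; rewrite le_max lexx ?orbT//.
Qed.

Lemma cboxM f g : continuous f -> cbox g -> cbox (fun p => f p * g p).
Proof.
move=> cf [cg [M g0]]; split; first by move=> p; apply: cvgM; [exact: cf|exact: cg].
by exists M => p /g0 ->; rewrite mulr0.
Qed.

Lemma cbox_shift f q : cbox f -> cbox (fun p => f (p + q)).
Proof.
move=> [cf [N f0]]; split.
  move=> p; apply: (@continuous_comp _ _ _ (fun p => p + q) f); last exact: cf.
  by apply: cvgD; [exact: cvg_id|exact: cvg_cst].
exists (N + `|q.1| + `|q.2|) => p H; apply: f0; apply: contra_not H.
rewrite !boxP /= => -[h1 h2].
have := ler_normB (p.1 + q.1) q.1; have := ler_normB (p.2 + q.2) q.2.
have := normr_ge0 q.1; have := normr_ge0 q.2; rewrite !addrK; lra.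
Qed.

Lemma cbox_Rintegral_shift f q : cbox f -> \int[mu2]_p f (p + q) = \int[mu2]_p f p.
Proof. by move=> [cf _]; exact: leb2_Rintegral_shift. Qed.

Lemma cbox_RintegralD f g : cbox f -> cbox g ->
  \int[mu2]_p (f p + g p) = \int[mu2]_p f p + \int[mu2]_p g p.
Proof. by move=> cf cg; rewrite RintegralD//; exact: cbox_integrable. Qed.

Lemma cbox_RintegralZ (c : R) f : cbox f ->
  \int[mu2]_p (c * f p) = c * \int[mu2]_p f p.
Proof. by move=> cf; rewrite RintegralZl//; exact: cbox_integrable. Qed.

Lemma Rintegral_gt0 h : cbox h -> (forall p, 0 <= h p) -> 0 < h (0, 0) ->
  0 < \int[mu2]_p h p.
Proof.
move=> ch h0 h00.
have [r /= r0 hr] : exists2 r : R, 0 < r & forall p, box r p -> h (0, 0) / 2 <= h p.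
  have /cvgrPdist_lt /(_ (h (0, 0) / 2)) := (ch.1 (0, 0)).
  move=> /(_ ltac:(lra)) /nbhs_ballP [e /= e0 He].
  exists (e / 2) => [|p /boxP [p1 p2]]; first by rewrite divr_gt0.
  have /He /= : ball ((0, 0) : R * R) e p.
    by split; rewrite /ball /= sub0r normrN; lra.
  by rewrite ltr_norml => /andP[_]; lra.
have ih := cbox_integrable ch.
have mh : measurable_fun setT (EFin \o h) by case/integrableP: ih.
have fin : (mu2 (box r) \is a fin_num) by rewrite ge0_fin_numE ?leb2_box_fin.
have pos : (0 < mu2 (box r))%E.
  rewrite /leb2 /box product_measure1E; [|exact: measurable_itv|exact: measurable_itv].
  have H : (0 < @lebesgue_measure R `[(- r)%R, r]%classic)%E.
    by rewrite lebesgue_measure_itv /= lte_fin ifT -?EFinB ?lte_fin; lra.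
  exact: mule_gt0.
rewrite -lte_fin /Rintegral fineK; last exact: integrable_fin_num.
apply: (@lt_le_trans _ _ ((h (0, 0) / 2)%:E * mu2 (box r))%E).
  by apply: mule_gt0 => //; rewrite lte_fin divr_gt0.
rewrite -integral_cst; last exact: measurable_box.
apply: (@le_trans _ _ (\int[mu2]_(p in box r) (EFin \o h) p)%E).
  apply: ge0_le_integral => //.
  - exact: measurable_box.
  - by move=> p _; rewrite lee_fin divr_ge0// ltW.
  - exact: measurable_funTS.
have := @ge0_subset_integral _ _ _ mu2 _ _ (measurable_box r) measurableT
  (EFin \o h) mh (fun p _ => _) (@subsetT _ _).
by apply => p; rewrite lee_fin.
Qed.

End Support.

(** * The wave equation as a parallelogram identity *)

Section Wave.
Context {R : realType}.
Notation mu2 := (@leb2 R).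
Implicit Types (k : R) (p q v : R * R) (f g h Y : R * R -> R).

Lemma scaler1 (a : R) : a *: (1 : R) = a.
Proof. exact: mulr1. Qed.

Lemma scalerE (a b : R) : a *: b = a * b.
Proof. by []. Qed.

Lemma derive_line f p v (x : R) : derivable f (p + x *: v) v ->
  is_derive x 1 (fun y : R => f (p + y *: v)) ('D_v f (p + x *: v)).
Proof.
rewrite /derivable /derive => H.
have E : (fun h : R => h^-1 *: (((fun y => f (p + y *: v)) \o shift x) (h *: 1) - f (p + x *: v))) =
         (fun h : R => h^-1 *: ((f \o shift (p + x *: v)) (h *: v) - f (p + x *: v))).
  apply/funext => h /=; congr (_ *: (f _ - _)).
  by rewrite scaler1 scalerDl addrCA.
by apply: DeriveDef; rewrite /derivable /derive E.
Qed.

(** The mean value theorem is used twice: for [u x = g (x + h) - g x] between [- h] and 0, then for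
    the derivative of [g] over a step [h]. *)
Lemma second_difference f v p (h : R) : 0 < h ->
  (forall q, derivable f q v) -> (forall q, derivable ('D_v f) q v) ->
  exists2 x : R, `|x| <= h & f (p + h *: v) - 2 * f p + f (p - h *: v) =
    h ^+ 2 * 'D_v ('D_v f) (p + x *: v).
Proof.
move=> h0 df ddf.
pose g (x : R) := f (p + x *: v).
pose g1 (x : R) := 'D_v f (p + x *: v).
have dg (x : R) : is_derive x 1 g (g1 x) by exact: derive_line.
have dg1 (x : R) : is_derive x 1 g1 ('D_v ('D_v f) (p + x *: v)) by exact: derive_line.
pose u (x : R) := g (x + h) - g x.
have du (x : R) : is_derive x 1 u (g1 (x + h) - g1 x).
  have H := is_derive1_comp (g := fun y => y + h) (dg (x + h)) (is_derive_shift x 1 h).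
  by rewrite mulr1 in H; exact: (is_deriveB H (dg x)).
have ctn (w w' : R -> R) : (forall x : R, is_derive x 1 w (w' x)) -> continuous w.
  by move=> dw x; apply/differentiable_continuous/derivable1_diffP; have [] := dw x.
have [c cI uE] := @MVT_segment R u _ (- h) 0 ltac:(lra) (fun x _ => du x) (continuous_subspaceT (ctn _ _ du)).
have [c' c'I gE] := @MVT_segment R g1 _ c (c + h) ltac:(lra) (fun x _ => dg1 x) (continuous_subspaceT (ctn _ _ dg1)).
exists c'.
  by move: cI c'I; rewrite !in_itv /= ler_norml; lra.
have -> : f (p + h *: v) - 2 * f p + f (p - h *: v) = u 0 - u (- h).
  by rewrite /u /g add0r addNr scale0r addr0 scaleNr; ring.
by rewrite uE gE; ring.
Qed.

(** In characteristic coordinates the wave operator is -4 k^2 times the mixed second derivative, so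
    the terms with [A2] and [B2] cancel. *)
Lemma wave_product k (A A1 B B1 A2 B2 : R -> R) p :
  (forall x : R, is_derive x 1 A (A1 x)) -> (forall x : R, is_derive x 1 A1 (A2 x)) ->
  (forall x : R, is_derive x 1 B (B1 x)) -> (forall x : R, is_derive x 1 B1 (B2 x)) ->
  let lp q := k * q.1 + 1 * q.2 + 0 in let lm q := - k * q.1 + 1 * q.2 + 0 in
  let phi := (fun q => A (lp q)) * (fun q => B (lm q)) in
  dt (dt phi) p - k ^+ 2 * ds (ds phi) p = - (4 * k ^+ 2) * (A1 (lp p) * B1 (lm p)).
Proof.
move=> dA dA1 dB dB1 lp lm phi.
have D (F F1 : R -> R) c q v : (forall x : R, is_derive x 1 F (F1 x)) ->
    is_derive q v (fun q => F (c * q.1 + 1 * q.2 + 0)) ((c * v.1 + 1 * v.2) *: F1 (c * q.1 + 1 * q.2 + 0)).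
  move=> dF; have [d E] := comp_affine (dF (c * q.1 + 1 * q.2 + 0)).
  by apply: DeriveDef; [exact: diff_derivable|rewrite E].
have D1 v q : 'D_v phi q = (k * v.1 + v.2) * (A1 (lp q) * B (lm q)) + (- k * v.1 + v.2) * (A (lp q) * B1 (lm q)).
  have [_ ->] := is_deriveM (D _ _ k q v dA) (D _ _ (- k) q v dB).
  by rewrite !scalerE !mul1r /lp /lm !mul1r; ring.
have D2 v : 'D_v ('D_v phi) p = (k * v.1 + v.2) ^+ 2 * (A2 (lp p) * B (lm p))
   + 2 * (k * v.1 + v.2) * (- k * v.1 + v.2) * (A1 (lp p) * B1 (lm p))
   + (- k * v.1 + v.2) ^+ 2 * (A (lp p) * B2 (lm p)).
  have -> : 'D_v phi = ((k * v.1 + v.2) \*: ((fun q => A1 (lp q)) * (fun q => B (lm q))) +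
     (- k * v.1 + v.2) \*: ((fun q => A (lp q)) * (fun q => B1 (lm q)))).
    by apply/funext => q; rewrite D1.
  have [_ ->] := is_deriveD
    (is_deriveZ (k * v.1 + v.2) (is_deriveM (D _ _ k p v dA1) (D _ _ (- k) p v dB)))
    (is_deriveZ (- k * v.1 + v.2) (is_deriveM (D _ _ k p v dA) (D _ _ (- k) p v dB1))).
  by rewrite !scalerE !mul1r /lp /lm !mul1r; ring.
by rewrite /dt /ds !D2 /et /es /=; ring.
Qed.

Definition sdiff f v p := f (p + v) - 2 * f p + f (p - v).

Lemma cbox_derive f v : continuous f -> (forall q, derivable f q v) ->
  continuous ('D_v f) -> cbox f -> cbox ('D_v f).
Proof.
move=> cf df cdf [_ [N f0]]; split => //; exists N => p; exact: box_derive.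
Qed.

Lemma continuous_shift Y v : continuous Y -> continuous (fun p => Y (p + v)).
Proof.
move=> cY p; apply: (@continuous_comp _ _ _ (fun p => p + v) Y); last exact: cY.
by apply: cvgD; [exact: cvg_id|exact: cvg_cst].
Qed.

Lemma Rintegral_mul_shift Y f v : continuous Y -> cbox f ->
  \int[mu2]_p (Y p * f (p + v)) = \int[mu2]_p (Y (p - v) * f p).
Proof.
move=> cY cf; rewrite -(@cbox_Rintegral_shift R (fun p => Y (p - v) * f p) v).
  by apply: eq_Rintegral => p _; rewrite addrK.
by apply: cboxM => //; exact: continuous_shift.
Qed.

(** Discrete integration by parts: the second difference is symmetric in [v] and [- v], and the
    measure is translation invariant. *)
Lemma sdiff_shift Y f v : continuous Y -> cbox f ->
  \int[mu2]_p (Y p * sdiff f v p) = \int[mu2]_p (sdiff Y v p * f p).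
Proof.
move=> cY cf.
have cs u : continuous (fun p => Y (p + u)) by exact: continuous_shift.
have C1 u : cbox (fun p => Y p * f (p + u)) by apply: cboxM => //; exact: cbox_shift.
have C2 u : cbox (fun p => Y (p + u) * f p) by exact: cboxM.
have C0 : cbox (fun p => Y p * f p) by exact: cboxM.
have cc (c : R) : continuous (fun _ : R * R => c) by move=> p; exact: cvg_cst.
have CZ : cbox (fun p => -2 * (Y p * f p)) by exact: (cboxM (cc _) C0).
transitivity (\int[mu2]_p (Y p * f (p + v)) + - 2 * \int[mu2]_p (Y p * f p)
   + \int[mu2]_p (Y p * f (p - v))).
  rewrite -cbox_RintegralZ// -cbox_RintegralD// -cbox_RintegralD//; last exact: cboxD.
  by apply: eq_Rintegral => p _; rewrite /sdiff; ring.
rewrite !Rintegral_mul_shift// opprK addrC addrA.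
rewrite -cbox_RintegralZ// -cbox_RintegralD// -cbox_RintegralD//; last exact: cboxD.
by apply: eq_Rintegral => p _; rewrite /sdiff; ring.
Qed.

Lemma smooth_iter f w v : smooth f -> (v = @et R \/ v = @es R) ->
  [/\ continuous (iter_partial w f), forall p, derivable (iter_partial w f) p v &
   exists w', 'D_v (iter_partial w f) = iter_partial w' f].
Proof.
move=> sf vE; have [cf pf] := sf w; split => //.
  by move=> p; have [? ?] := pf p; case: vE => ->.
by case: vE => ->; [exists (true :: w)|exists (false :: w)].
Qed.

Lemma cbox_derive2 f v : v = @et R \/ v = @es R -> smooth f -> cbox f ->
  cbox ('D_v ('D_v f)).
Proof.
move=> vE sf cf.
have [cf0 df [w1 E1]] := smooth_iter [::] sf vE.
have [cf1 ddf [w2 E2]] := smooth_iter w1 sf vE.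
have [cf2 _ _] := smooth_iter w2 sf vE.
rewrite -E1 /= in cf1 ddf E2; rewrite -E2 in cf2.
exact: cbox_derive cf1 ddf cf2 (cbox_derive cf0 df cf1 cf).
Qed.

Lemma cbox_sdiff f v : cbox f -> cbox (sdiff f v).
Proof.
move=> cf; have c2 : continuous (fun _ : R * R => - 2 : R) by move=> p; exact: cvg_cst.
have := cboxD (cboxD (cbox_shift v cf) (cboxM c2 cf)) (cbox_shift (- v) cf).
by congr cbox; apply/funext => p; rewrite /sdiff; ring.
Qed.

Lemma box_indic_integrable (N c : R) :
  mu2.-integrable setT (fun p => (c * \1_(box N) p)%:E).
Proof.
have H : mu2.-integrable (box N) (EFin \o cst c).
  apply: measurable_bounded_integrable.
  - exact: measurable_box.
  - exact: leb2_box_fin.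
  - exact: measurable_cst.
  - by exists `|c|; split; [exact: num_real|move=> x cx p _ /=; exact: ltW].
rewrite integrable_mkcond in H; last exact: measurable_box.
apply: eq_integrable H => // p _.
by rewrite /= patchE indicE; case: ifPn => _; rewrite ?mulr1 ?mulr0.
Qed.

(* Second difference quotients are values of the second derivative at nearby
   points, so they converge boundedly. *)
Lemma sdiff_cvg (c : R) Y f v : 0 < c -> v = @et R \/ v = @es R ->
  continuous Y -> smooth f -> cbox f ->
  ((c / n.+1%:R) ^- 2 * \int[mu2]_p (Y p * sdiff f ((c / n.+1%:R) *: v) p)) @[n --> \oo] -->
  \int[mu2]_p (Y p * 'D_v ('D_v f) p).
Proof.
move=> c0 vE cY sf cf.
have [cf0 df [w1 E1]] := smooth_iter [::] sf vE.
have [cf1 ddf [w2 E2]] := smooth_iter w1 sf vE.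
have [cf2 _ _] := smooth_iter w2 sf vE.
rewrite -E1 /= in cf1 ddf E2; rewrite -E2 in cf2.
rewrite /= in cf0 df.
have c2 := cbox_derive2 vE sf cf.
have [N f2N] := c2.2.
(* One box for all [n]: steps have length at most [c], so every second difference vanishes outside
   the support box enlarged by [c]. *)
pose N' := `|N| + c.
pose h n : R := c / n.+1%:R.
have h0 n : 0 < h n by rewrite divr_gt0.
have hc n : h n <= c by rewrite ler_pdivrMr// ler_peMr ?ler1n// ltW.
pose g p := Y p * 'D_v ('D_v f) p.
pose gn n p := Y p * ((h n) ^- 2 * sdiff f (h n *: v) p).
(* The intermediate points of [second_difference] yield both the domination and, as [x n] tends to
   0, the pointwise limit. *)
have rep p : exists x : nat -> R, forall n, `|x n| <= h n /\
    gn n p = Y p * 'D_v ('D_v f) (p + x n *: v).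
  suff H n : exists x : R, `|x| <= h n /\ gn n p = Y p * 'D_v ('D_v f) (p + x *: v).
    by have [x Hx] := choice H; exists x.
  have [x xh E] := second_difference (f := f) p (h0 n) df ddf.
  exists x; split => //; rewrite /gn /sdiff E mulKf//.
  by rewrite expf_neq0// gt_eqF.
have v1 : `|v.1| <= 1 /\ `|v.2| <= 1.
  by case: vE => ->; rewrite /et /es /= normr0 normr1.
have near_box (M M' x : R) p : `|x| <= M' -> box M p -> box (M + M') (p + x *: v).
  rewrite !boxP /= => xM [p1 p2].
  have xv (y : R) : `|y| <= 1 -> `|x * y| <= M'.
    by move=> y1; rewrite normrM (le_trans _ xM)// ler_piMr.
  by split; rewrite (le_trans (ler_normD _ _))// lerD// scalerE; apply: xv; case: v1.
have [M HM] := continuous_box_bounded (N' + c) cf2.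
have [MY HMY] := continuous_box_bounded N' cY.
have gn0 n p : ~ box N' p -> gn n p = 0.
  move=> pN; have [x /(_ n)[xh ->]] := rep p; rewrite f2N ?mulr0//.
  apply: contra_not pN => /(near_box _ c (- x n)).
  rewrite normrN scaleNr addrK => /(_ (le_trans xh (hc n))).
  by apply: boxW; rewrite /N' lerD2r ler_norm.
have cgn n : cbox (gn n).
  have cc : continuous (fun _ : R * R => h n ^- 2 : R) by move=> p; exact: cvg_cst.
  exact: cboxM (cboxM cc (cbox_sdiff (h n *: v) cf)).
have bound n p : `|gn n p| <= `|MY| * `|M| * \1_(box N') p.
  have [pN|pN] := pselect (box N' p); last first.
    by rewrite gn0// normr0 mulr_ge0// mulr_ge0.
  rewrite indicE mem_set// mulr1.
  have [x /(_ n)[xh ->]] := rep p.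
  rewrite normrM ler_pM//.
    by rewrite (le_trans (HMY p pN))// ler_norm.
  by rewrite (le_trans (HM _ _)) ?ler_norm//; apply: near_box => //; exact: le_trans (hc n).
have lim p : gn n p @[n --> \oo] --> g p.
  have [x Hx] := rep p.
  have -> : gn ^~ p = (fun n => Y p * 'D_v ('D_v f) (p + x n *: v)).
    by apply/funext => n; case: (Hx n).
  apply: cvgM; first exact: cvg_cst.
  have x0 : x n @[n --> \oo] --> (0 : R).
    have : h n @[n --> \oo] --> (0 : R).
      by rewrite -[X in _ --> X](mulr0 c); apply: cvgM; [exact: cvg_cst|exact: cvg_harmonic].
    move=> /cvgr0Pnorm_le H; apply/cvgr0Pnorm_le => e /H; apply: filterS => n.
    by rewrite (gtr0_norm (h0 n)) => /(le_trans (Hx n).1).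
  have H : (p + x n *: v) @[n --> \oo] --> p.
    rewrite -[X in _ --> X]addr0 -(scale0r v); apply: cvgD; first exact: cvg_cst.
    exact: cvgZr_tmp.
  exact: (cvg_comp _ _ H (cf2 p)).
have mgn n : measurable_fun setT (EFin \o gn n).
  by apply/measurable_EFinP; apply: continuous_measurable2; exact: (cgn n).1.
have cg : cbox g by exact: cboxM.
have mg : measurable_fun setT (EFin \o g).
  by apply/measurable_EFinP; apply: continuous_measurable2; exact: cg.1.
have ib := box_indic_integrable N' (`|MY| * `|M|).
have lim' : {ae mu2, forall p, setT p -> (EFin \o gn n) p @[n --> \oo] --> (EFin \o g) p}.
  by apply: aeW => p _; apply: cvg_EFin; [exact: nearW|exact: lim].
have dom : {ae mu2, forall p, forall n : nat, setT p ->
    (`|(EFin \o gn n) p| <= (`|MY| * `|M| * \1_(box N') p)%:E)%E}.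
  by apply: aeW => p n _; rewrite lee_fin bound.
have [_ _ H] := @dominated_convergence _ _ _ mu2 setT measurableT
  (fun n => EFin \o gn n) (EFin \o g) _ mgn mg lim' ib dom.
have fing : (\int[mu2]_p (EFin \o g) p)%E \is a fin_num.
  exact: integrable_fin_num (cbox_integrable cg).
rewrite -[X in _ --> X](_ : fine (\int[mu2]_p (EFin \o g) p)%E = _)//.
have -> : (fun n => (c / n.+1%:R) ^- 2 * \int[mu2]_p (Y p * sdiff f ((c / n.+1%:R) *: v) p)) =
    fine \o (fun n => \int[mu2]_p (EFin \o gn n) p)%E.
  apply/funext => n; rewrite -cbox_RintegralZ; last exact: cboxM (cbox_sdiff _ cf).
  by apply: eq_Rintegral => p _; rewrite mulrCA.
by apply: fine_cvg; rewrite fineK.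
Qed.

(** With steps [h] in time and [k * h] in space, the two second differences of [Y] coincide. The
    factor [k ^+ 2] compensates the different step lengths, so the approximating sequences agree
    term by term. *)
Lemma parallelogram_wave Y k f : 0 < k -> continuous Y ->
  (forall p (h : R), Y (p + h *: @et R) + Y (p - h *: @et R) =
               Y (p + (k * h) *: @es R) + Y (p - (k * h) *: @es R)) ->
  test_function f ->
  \int[mu2]_p (Y p * dt (dt f) p) = k ^+ 2 * \int[mu2]_p (Y p * ds (ds f) p).
Proof.
move=> k0 cY HY tf; have sf := tf.1.
have cf : cbox f.
  by split; [have [] := sf [::]|exact: test_function_box].
have L1 := sdiff_cvg (v := @et R) ltr01 (or_introl erefl) cY sf cf.
have L2 := sdiff_cvg (v := @es R) k0 (or_intror erefl) cY sf cf.
have L3 : (k ^+ 2 * ((k / n.+1%:R) ^- 2 * \int[mu2]_p (Y p * sdiff f ((k / n.+1%:R) *: @es R) p))) @[n --> \oo] -->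
    k ^+ 2 * \int[mu2]_p (Y p * ds (ds f) p).
  by apply: cvgM; [exact: cvg_cst|exact: L2].
apply: (cvg_unique _ L1); first exact: norm_hausdorff.
apply: cvg_trans L3; apply: near_eq_cvg; apply: nearW => n.
rewrite !sdiff_shift// mulrA; congr (_ * _).
  have : n.+1%:R != 0 :> R by [].
  by move: n.+1%:R => m m0; field; rewrite ?m0 ?gt_eqF.
apply: eq_Rintegral => p _; congr (_ * _).
by have := HY p n.+1%:R^-1; rewrite /sdiff div1r; lra.
Qed.

(** The inverse of the characteristic coordinates: the point (t, s) with s + k t = a and s - k t =
    b. *)
Definition pt k (a b : R) : R * R := ((a - b) / (2 * k), (a + b) / 2).

Lemma step_eq (e x y : R) : (e <= x /\ e <= y) \/ (x <= - e /\ y <= - e) ->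
  step e x = step e y.
Proof.
wlog xy : x y / x <= y => [H xye|].
  have /orP[xy|xy] := le_total x y; first exact: H.
  by apply/esym/H => //; case: xye => -[? ?]; [left|right].
move=> H; apply: step_const => // z /andP[xz zy]; rewrite ler_normr.
by case: H => -[? ?]; apply/orP; [left|right]; lra.
Qed.

Lemma shift_derive (F F1 : R -> R) (a x : R) : (forall y : R, is_derive y 1 F (F1 y)) ->
  is_derive x 1 (fun y => F (y - a)) (F1 (x - a)).
Proof.
move=> dF.
have H := is_derive1_comp (g := fun y => y - a) (dF (x - a)) (is_derive_shift x 1 (- a)).
by rewrite mulr1 in H; exact: H.
Qed.

Lemma char_box k (N : R) p : 0 < k -> k < 1 ->
  `|k * p.1 + 1 * p.2 + 0| <= N -> `|- k * p.1 + 1 * p.2 + 0| <= N -> box (N / k) p.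
Proof.
move=> k0 k1; rewrite mul1r addr0 => H1 H2; rewrite boxP.
have N0 : 0 <= N by exact: le_trans H1.
split; rewrite ler_pdivlMr//.
  rewrite -[X in _ * X](gtr0_norm k0) -normrM; move: H1 H2; rewrite !ler_norml; lra.
apply: (@le_trans _ _ `|p.2|); first by rewrite ler_piMr// ltW.
by move: H1 H2; rewrite !ler_norml; lra.
Qed.

Lemma weak_kernel Y k (u w K : R * R -> R) : 0 < k -> continuous Y -> cbox u -> cbox w ->
  \int[mu2]_p (Y p * u p) = k ^+ 2 * \int[mu2]_p (Y p * w p) ->
  (forall p, u p - k ^+ 2 * w p = - (4 * k ^+ 2) * K p) ->
  \int[mu2]_p (Y p * K p) = 0.
Proof.
move=> k0 cY cu cw H E.
have cc (c : R) : continuous (fun _ : R * R => c) by move=> p; exact: cvg_cst.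
have cYu := cboxM cY cu; have cYw := cboxM cY cw; have cYw' := cboxM (cc (- k ^+ 2)) cYw.
transitivity (\int[mu2]_p (- (4 * k ^+ 2)^-1 * (Y p * u p + - k ^+ 2 * (Y p * w p)))).
  apply: eq_Rintegral => p _; transitivity (- (4 * k ^+ 2)^-1 *
    (Y p * (u p - k ^+ 2 * w p))); last by ring.
  by rewrite E; field; rewrite gt_eqF.
rewrite (cbox_RintegralZ _ (cboxD cYu cYw')) (cbox_RintegralD cYu cYw').
by rewrite (cbox_RintegralZ _ cYw) H; ring.
Qed.

(* The test function is a product of two functions of the characteristic
   variables whose derivatives are differences of concentrated bumps. *)
Lemma wave_parallelogram Y k (a0 a1 b0 b1 : R) : 0 < k -> k < 1 -> continuous Y ->
  (forall f, test_function f ->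
    \int[mu2]_p (Y p * dt (dt f) p) = k ^+ 2 * \int[mu2]_p (Y p * ds (ds f) p)) ->
  Y (pt k a1 b1) - Y (pt k a1 b0) - Y (pt k a0 b1) + Y (pt k a0 b0) = 0.
Proof.
move=> k0 k1 cY wY.
pose lp q := k * q.1 + 1 * q.2 + 0; pose lm q := - k * q.1 + 1 * q.2 + 0.
pose D p := Y (p + pt k a1 b1) - Y (p + pt k a1 b0) - Y (p + pt k a0 b1) + Y (p + pt k a0 b0).
pose K e p : R := bump e (lp p) * bump e (lm p).
have Ksupp e p : ~ box (e / k) p -> K e p = 0.
  move=> pN; rewrite /K; have [H1|/ltW H1] := lerP e `|lp p|; first by rewrite bump_eq0// mul0r.
  have [H2|/ltW H2] := lerP e `|lm p|; first by rewrite mulrC bump_eq0// mul0r.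
  by case: pN; exact: char_box.
have cbK e : cbox (K e).
  split; last by exists (e / k) => p; exact: Ksupp.
  move=> p; apply/differentiable_continuous/sm2_differentiable.
  by apply: sm2_mul; apply: sm2_comp; exact: sm_bump.
have DK e : 0 < e -> \int[mu2]_p (D p * K e p) = 0.
  move=> e0.
  (* A single step has unbounded support; two translates take the same constant value far out on
     either side, so their difference vanishes there. *)
  pose A x := step e (x - a1) - step e (x - a0).
  pose B x := step e (x - b1) - step e (x - b0).
  pose A1 x := bump e (x - a1) - bump e (x - a0).
  pose B1 x := bump e (x - b1) - bump e (x - b0).
  pose phi := (fun q => A (lp q)) * (fun q => B (lm q)).
  have supp c c' x : `|c| + `|c'| + e <= `|x| -> step e (x - c) - step e (x - c') = 0.
    move=> H; apply/eqP; rewrite subr_eq0; apply/eqP/step_eq.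
    have := ler_norm c; have := ler_norm c'; have := ler_norm (- c); have := ler_norm (- c').
    rewrite !normrN => h1 h2 h3 h4; move: H; rewrite ler_normr => /orP[H|H]; [left|right]; split; lra.
  have sphi : smooth phi.
    apply: sm2_smooth; apply: sm2_mul.
      have -> : (fun q => A (lp q)) = (fun q => step e (k * q.1 + 1 * q.2 + (- a1))) +
          (-1) \*: (fun q => step e (k * q.1 + 1 * q.2 + (- a0))).
        by apply/funext => q; rewrite !fctE /= scaleN1r /A /lp !addr0.
      by apply: sm2_add; [|apply: sm2_scale]; apply: sm2_comp; exact: sm_step.
    have -> : (fun q => B (lm q)) = (fun q => step e (- k * q.1 + 1 * q.2 + (- b1))) +
        (-1) \*: (fun q => step e (- k * q.1 + 1 * q.2 + (- b0))).
      by apply/funext => q; rewrite !fctE /= scaleN1r /B /lm !addr0.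
    by apply: sm2_add; [|apply: sm2_scale]; apply: sm2_comp; exact: sm_step.
  pose N := `|a1| + `|a0| + e + (`|b1| + `|b0| + e).
  have phi0 p : ~ box (N / k) p -> phi p = 0.
    move=> pN; rewrite /phi fctE.
    have na := normr_ge0 a0; have na' := normr_ge0 a1; have nb := normr_ge0 b0; have nb' := normr_ge0 b1.
    have [H1|/ltW H1] := lerP (`|a1| + `|a0| + e) `|lp p|; first by rewrite /A supp// mul0r.
    have [H2|/ltW H2] := lerP (`|b1| + `|b0| + e) `|lm p|; first by rewrite /B [X in _ * X]supp// mulr0.
    by case: pN; apply: char_box => //; [apply: le_trans H1 _|apply: le_trans H2 _]; rewrite /N; lra.
  have tphi : test_function phi.
    split => //; apply: (@subclosed_compact _ _ (box (N / k))).
    - exact: closed_closure.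
    - exact: compact_box.
    - rewrite (closure_id (box (N / k))).1; last exact: closed_box.
      by apply: closureS => p /= /eqP; apply: contra_notP; exact: phi0.
  have [bump' _ dbump] := sm_derive (sm_bump e).
  have dA2 (x : R) : is_derive x 1 A1 (bump' (x - a1) - bump' (x - a0)).
    by apply: is_deriveB; exact: shift_derive.
  have dB2 (x : R) : is_derive x 1 B1 (bump' (x - b1) - bump' (x - b0)).
    by apply: is_deriveB; exact: shift_derive.
  have dA (x : R) : is_derive x 1 A (A1 x).
    by apply: is_deriveB; apply: shift_derive => y; exact: is_derive_step.
  have dB (x : R) : is_derive x 1 B (B1 x).
    by apply: is_deriveB; apply: shift_derive => y; exact: is_derive_step.
  have E p := wave_product k p dA dA2 dB dB2.
  have cphi : cbox phi by split; [have [] := sphi [::]|exists (N / k)].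
  have ctt : cbox (dt (dt phi)) by apply: cbox_derive2 => //; left.
  have css : cbox (ds (ds phi)) by apply: cbox_derive2 => //; right.
  have H0 := weak_kernel k0 cY ctt css (wY _ tphi) E.
  have cc (c : R) : continuous (fun _ : R * R => c) by move=> p; exact: cvg_cst.
  (* The product [A1 * B1] expands into four signed translates of [K e] centred at the corners
     [pt k a b]. Shifting each back to the origin moves the corners into the argument of [Y] and
     produces [D]. *)
  pose Kq q p := K e (p - q).
  have cKq q : cbox (fun p => Y p * Kq q p) by apply: cboxM cY (cbox_shift _ (cbK e)).
  have cKm q (c : R) : cbox (fun p => c * (Y p * Kq q p)) by exact: cboxM (cc c) (cKq q).
  have cDm q (c : R) : cbox (fun p => c * (Y (p + q) * K e p)).
    by apply: cboxM (cc c) (cboxM _ (cbK e)); exact: continuous_shift.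
  have T q (c : R) : \int[mu2]_p (c * (Y (p + q) * K e p)) = \int[mu2]_p (c * (Y p * Kq q p)).
    have cq : cbox (fun p => Y (p + q) * K e p).
      by apply: cboxM (cbK e); exact: continuous_shift.
    rewrite (cbox_RintegralZ _ cq) (cbox_RintegralZ _ (cKq q)).
    by rewrite /Kq (Rintegral_mul_shift _ cY (cbK e)) opprK.
  have sum4 f1 f2 f3 f4 : cbox f1 -> cbox f2 -> cbox f3 -> cbox f4 ->
      \int[mu2]_p (f1 p + f2 p + f3 p + f4 p) =
      \int[mu2]_p f1 p + \int[mu2]_p f2 p + \int[mu2]_p f3 p + \int[mu2]_p f4 p.
    move=> c1 c2 c3 c4.
    by rewrite (cbox_RintegralD (cboxD (cboxD c1 c2) c3) c4)
      (cbox_RintegralD (cboxD c1 c2) c3) (cbox_RintegralD c1 c2).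
  transitivity (\int[mu2]_p (1 * (Y (p + pt k a1 b1) * K e p)) + \int[mu2]_p (- 1 * (Y (p + pt k a1 b0) * K e p))
     + \int[mu2]_p (- 1 * (Y (p + pt k a0 b1) * K e p)) + \int[mu2]_p (1 * (Y (p + pt k a0 b0) * K e p))).
    rewrite -(sum4 _ _ _ _ (cDm _ _) (cDm _ _) (cDm _ _) (cDm _ _)).
    by apply: eq_Rintegral => p _; rewrite /D; ring.
  rewrite !T -(sum4 _ _ _ _ (cKm _ _) (cKm _ _) (cKm _ _) (cKm _ _)).
  rewrite -[RHS]H0; apply: eq_Rintegral => p _.
  have EK a b : Kq (pt k a b) p = bump e (lp p - a) * bump e (lm p - b).
    rewrite /Kq /K; congr (bump e _ * bump e _); rewrite /lp /lm /pt /=; field; rewrite gt_eqF//.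
  by rewrite !EK /A1 /B1; ring.
have cD : continuous D.
  move=> p; apply: cvgD; [apply: cvgB; [apply: cvgB|]|]; exact: continuous_shift.
have D0 : D (0, 0) = 0.
  apply/eqP; apply: contraT => D00.
  (* Multiplying [D] by its value at the origin treats both signs at once. *)
  have d2 : 0 < D (0, 0) * D (0, 0) by rewrite -expr2 exprn_even_gt0.
  have [r r0 hr] : exists2 r : R, 0 < r & forall p, box r p -> 0 <= D (0, 0) * D p.
    have cG : continuous (fun p => D (0, 0) * D p).
      by move=> p; apply: cvgM; [exact: cvg_cst|exact: cD].
    have /cvgrPdist_lt /(_ _ d2) := cG (0, 0).
    move=> /nbhs_ballP [e /= e0 He]; exists (e / 2) => [|p /boxP [p1 p2]]; first by rewrite divr_gt0.
    have /He /= : ball ((0, 0) : R * R) e p by split; rewrite /ball /= sub0r normrN; lra.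
    by rewrite ltr_norml => /andP[_]; lra.
  (* With this width, [K] vanishes outside [box r], where the sign of [D] is known. *)
  have e0 : 0 < r * k by rewrite mulr_gt0.
  have ch : cbox (fun p => D (0, 0) * (D p * K (r * k) p)).
    by apply: cboxM (cboxM cD (cbK _)) => p; exact: cvg_cst.
  have : 0 < \int[mu2]_p (D (0, 0) * (D p * K (r * k) p)).
    apply: Rintegral_gt0 => // [p|].
      rewrite mulrA; have [pr|pr] := pselect (box r p).
        by rewrite mulr_ge0 ?hr// mulr_ge0 ?bump_ge0.
      by rewrite Ksupp ?mulr0// mulfK// gt_eqF.
    by rewrite mulrA mulr_gt0// mulr_gt0// bump_gt0// /lp /lm /= !mulr0 !addr0 normr0.
  by rewrite (cbox_RintegralZ _ (cboxM cD (cbK _))) (DK _ e0) mulr0 ltxx.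
by move: D0; rewrite /D -[(0, 0)]/(0 : R * R) !add0r.
Qed.

End Wave.

(** * Euclidean norm *)

Section Euclid.
Context {R : realType} {d : nat}.
Implicit Types (u v w : 'rV[R]_d) (a : R).

Lemma dotvC u v : dotv u v = dotv v u.
Proof. by apply: eq_bigr => i _; rewrite mulrC. Qed.

Lemma dotvDl u v w : dotv (u + v) w = dotv u w + dotv v w.
Proof. by rewrite /dotv -big_split; apply: eq_bigr => i _; rewrite mxE mulrDl. Qed.

Lemma dotvZl a u v : dotv (a *: u) v = a * dotv u v.
Proof. by rewrite /dotv mulr_sumr; apply: eq_bigr => i _; rewrite mxE mulrA. Qed.

Lemma dotvDr u v w : dotv u (v + w) = dotv u v + dotv u w.
Proof. by rewrite dotvC dotvDl !(dotvC u). Qed.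

Lemma dotvZr a u v : dotv u (a *: v) = a * dotv u v.
Proof. by rewrite dotvC dotvZl dotvC. Qed.

Lemma dotv_ge0 u : 0 <= dotv u u.
Proof. by apply: sumr_ge0 => i _; rewrite -expr2 sqr_ge0. Qed.

Lemma enorm_ge0 u : 0 <= enorm u. Proof. exact: sqrtr_ge0. Qed.

Lemma enorm_sqr u : enorm u ^+ 2 = dotv u u.
Proof. by rewrite sqr_sqrtr// dotv_ge0. Qed.

Lemma dotv0 u : dotv u 0 = 0.
Proof. by rewrite -(scale0r 0) dotvZr mul0r. Qed.

Lemma enorm0 : enorm (0 : 'rV[R]_d) = 0.
Proof. by rewrite /enorm dotv0 sqrtr0. Qed.

Lemma coord_le_enorm u (i : 'I_d) : `|u ord0 i| <= enorm u.
Proof.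
rewrite -sqrtr_sqr; apply: ler_wsqrtr; rewrite /dotv (bigD1 i)//= expr2 lerDl.
by apply: sumr_ge0 => j _; rewrite -expr2 sqr_ge0.
Qed.

Lemma enorm_eq0 u : enorm u = 0 -> u = 0.
Proof.
move=> u0; apply/rowP => i; rewrite mxE; apply/eqP; rewrite -normr_le0 -u0.
exact: coord_le_enorm.
Qed.

Lemma enormZ a u : enorm (a *: u) = `|a| * enorm u.
Proof. by rewrite /enorm dotvZl dotvZr mulrA -expr2 sqrtrM ?sqr_ge0// sqrtr_sqr. Qed.

Lemma enormN u : enorm (- u) = enorm u.
Proof. by rewrite -scaleN1r enormZ normrN1 mul1r. Qed.

Lemma dotv_le u v : dotv u v <= enorm u * enorm v.
Proof.
have [/eqP u0|u0] := boolP (enorm u == 0).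
  by rewrite (enorm_eq0 u0) dotvC dotv0 enorm0 mul0r.
have [/eqP v0|v0] := boolP (enorm v == 0).
  by rewrite (enorm_eq0 v0) dotv0 enorm0 mulr0.
have up : 0 < enorm u by rewrite lt_neqAle eq_sym u0 enorm_ge0.
have vp : 0 < enorm v by rewrite lt_neqAle eq_sym v0 enorm_ge0.
(* Rescaled to equal length, the vectors have a difference whose squared norm is 2 |u| |v| (|u| |v|
   - u.v). *)
have := dotv_ge0 (enorm v *: u + (- enorm u) *: v).
rewrite !dotvDl !dotvDr !dotvZl !dotvZr -!enorm_sqr (dotvC v u) => H.
have : 0 <= 2 * (enorm u * enorm v) * (enorm u * enorm v - dotv u v).
  by move: H; congr (_ <= _); ring.
by rewrite pmulr_rge0 ?subr_ge0// !mulr_gt0.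
Qed.

Lemma enormD u v : enorm (u + v) <= enorm u + enorm v.
Proof.
rewrite -(@ler_pXn2r _ 2)// ?nnegrE ?enorm_ge0 ?addr_ge0 ?enorm_ge0//.
rewrite enorm_sqr dotvDl !dotvDr -!enorm_sqr (dotvC v u).
by have := dotv_le u v; rewrite sqrrD; lra.
Qed.

Lemma enormB u v : enorm (u - v) = enorm (v - u).
Proof. by rewrite -enormN opprB. Qed.

Lemma enorm_triangle u v w : enorm (u - w) <= enorm (u - v) + enorm (v - w).
Proof. by rewrite (le_trans _ (enormD _ _))// addrA subrK. Qed.

Lemma norm_le_enorm u : `|u| <= enorm u.
Proof.
rewrite /Num.Def.normr /=; have [->|/mx_norm_neq0 [[i j] ->]] := eqVneq (mx_norm u) 0.
  exact: enorm_ge0.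
by rewrite /= ord1; exact: coord_le_enorm.
Qed.

Lemma coord_le_norm u (i : 'I_d) : `|u ord0 i| <= `|u|.
Proof.
rewrite [leRHS]/Num.Def.normr /= mx_normrE.
exact: (le_bigmax _ (fun i : 'I_1 * 'I_d => `|u i.1 i.2|) (ord0, i)).
Qed.

Lemma enorm_le_norm u : enorm u <= d%:R * `|u|.
Proof.
rewrite -(@ler_pXn2r _ 2)// ?nnegrE ?enorm_ge0 ?mulr_ge0//.
rewrite enorm_sqr (@le_trans _ _ (\sum_(i < d) `|u| ^+ 2))//.
  apply: ler_sum => i _; rewrite -expr2 -real_normK ?num_real//.
  by rewrite lerXn2r ?nnegrE// coord_le_norm.
rewrite sumr_const card_ord exprMn -[leLHS]mulr_natl ler_wpM2r ?exprn_ge0//.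
by rewrite -natrX ler_nat; case: (d) => // n; rewrite leq_pmulr.
Qed.

End Euclid.
(** * Locally Lipschitz curves *)

Section LocalLip.
Context {R : realType}.
Notation mu := (@lebesgue_measure R).
Implicit Types (f : R -> R) (a b c L N : R).

(** The regularity available for the coordinates of F and G before the constraints are used: the
    constant may grow with the interval. *)
Definition lip_bounded f := forall N, exists L, forall x y,
  `|x| <= N -> `|y| <= N -> `|f x - f y| <= L * `|x - y|.

(** The nonexpansive projection onto [-N, N]; precomposition with it turns a [lip_bounded] function
    into a globally Lipschitz one that is unchanged inside. *)
Definition clip N x : R := Num.max (- N) (Num.min x N).

Lemma clip_id N x : `|x| <= N -> clip N x = x.
Proof.
rewrite ler_norml => /andP[h1 h2].
by rewrite /clip (min_idPl h2) (max_idPr h1).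
Qed.

Lemma clip_norm N x : 0 <= N -> `|clip N x| <= N.
Proof.
move=> N0; rewrite ler_norml /clip le_max lexx /= ge_max ge_min lexx orbT andbT.
by rewrite ge0_cp.
Qed.

Lemma clip_dist N x y : `|clip N x - clip N y| <= `|x - y|.
Proof.
rewrite /clip /Num.max /Num.min.
have h1 := ler_norm (x - y); have h2 := ler_norm (y - x); rewrite distrC in h2.
by case: (ltP x N) => ?; case: (ltP y N) => ?; case: (ltP (- N) x) => ?;
  case: (ltP (- N) y) => ?; case: (ltP (- N) N) => ?; rewrite ler_norml; lra.
Qed.

Lemma clip_lip f N : 0 <= N -> lip_bounded f ->
  exists L, forall x y, `|f (clip N x) - f (clip N y)| <= L * `|x - y|.
Proof.
move=> N0 /(_ N)[L HL]; exists `|L| => x y.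
rewrite (le_trans (HL _ _ (clip_norm _ N0) (clip_norm _ N0)))//.
by rewrite (le_trans (ler_wpM2r _ (ler_norm L)))// ler_wpM2l// clip_dist.
Qed.

Lemma clip_near f N x : `|x| < N -> \forall y \near x, f (clip N y) = f y.
Proof.
rewrite ltr_norml => /andP[h1 h2]; near=> y; rewrite clip_id// ler_norml.
apply/andP; split; apply: ltW; near: y; [exact: lt_nbhsr|exact: lt_nbhsl].
Unshelve. all: by end_near. Qed.

Lemma lip_bounded_ae_derivable f : lip_bounded f -> {ae mu, forall x, derivable f x 1}.
Proof.
move=> lf.
have H (n : nat) : {ae mu, forall x, derivable (f \o clip n%:R) x 1}.
  by have [L HL] := clip_lip (ler0n R n) lf; exact: lip_ae_derivable HL.
have := ae_foralln H; apply: filterS => x Hx.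
have xn : `|x| < (Num.bound `|x|)%:R by exact: archi_boundP.
have [] := near_eq_is_derive (clip_near f xn) (derivableP (Hx _)).
by [].
Qed.

Lemma lip_bounded_derive_le f a b c : lip_bounded f -> 0 <= c ->
  {ae mu, forall x, derivable f x 1 -> 'D_1 f x <= c} -> a <= b ->
  f b - f a <= c * (b - a).
Proof.
move=> lf c0 H ab.
pose N := `|a| + `|b| + 1.
have N0 : 0 <= N by rewrite /N !addr_ge0.
have aN : `|a| <= N by rewrite /N -addrA lerDl addr_ge0.
have bN : `|b| <= N by rewrite /N addrAC lerDr addr_ge0.
have [L HL] := clip_lip N0 lf.
rewrite -{1}(clip_id aN) -{1}(clip_id bN).
apply: (lip_derive_le (f := f \o clip N) HL _ ab).
(* The kinks of [clip N] at [N] and [- N] are null. Beyond them the clipped function is locally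
   constant, and its derivative 0 obeys the bound because [0 <= c]. *)
have ne (z : R) : {ae mu, forall x, x != z}.
  exists [set z]; split; [exact: measurable_set1|exact: lebesgue_measure_set1|].
  by move=> x /= /negP; rewrite negbK => /eqP.
move: H (ne N) (ne (- N)); apply: filterS3 => x Hx xN xN' dx.
have [xlt|xge] := ltP `|x| N.
  have E := clip_near f xlt.
  have [d1 d2] := near_eq_is_derive E (derivableP dx).
  by rewrite -d2; exact: Hx.
have E : \forall y \near x, cst (f (clip N x)) y = (f \o clip N) y.
  move: xge; rewrite ler_normr => /orP[xge|xge].
    have xgt : N < x by rewrite lt_neqAle eq_sym xN.
    near=> y.
    have yN : N < y by near: y; exact: lt_nbhsr.
    by rewrite /= /clip (min_idPr (ltW xgt)) (min_idPr (ltW yN)).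
  have xgt : x < - N by rewrite lt_neqAle xN' lerNr.
  near=> y.
  have yN : y < - N by near: y; exact: lt_nbhsl.
  by rewrite /= /clip (max_idPl _) ?(max_idPl _)// ge_min ltW.
by have [_ ->] := near_eq_is_derive E (is_derive_cst (f (clip N x)) x 1).
Unshelve. all: by end_near. Qed.

Context {d : nat}.
Definition vlip (F : R -> 'rV[R]_d) := forall i, lip_bounded (fun x => F x ord0 i).

Lemma vlip_ae_derivable F : vlip F -> {ae mu, forall x, derivable F x 1}.
Proof.
move=> lF.
have H : {ae mu, forall x, forall i, derivable (fun x => F x ord0 i) x 1}.
  apply: filter_forall => i; exact: lip_bounded_ae_derivable.
by move: H; apply: filterS => x Hx; apply/derivable_mxP => i j; rewrite ord1.
Qed.

Lemma dotv_derive (F : R -> 'rV[R]_d) w x : derivable F x 1 ->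
  is_derive x 1 (fun y => dotv w (F y)) (dotv w ('D_1 F x)).
Proof.
move=> dF; have /derivable_mxP dFi := dF.
have -> : (fun y => dotv w (F y)) = \sum_(i < d) (w ord0 i \*: (fun y => F y ord0 i)).
  by apply/funext => y; rewrite fct_sumE.
rewrite derive_mx// [X in is_derive _ _ _ X](_ : _ = \sum_(i < d) w ord0 i *: 'D_1 (fun y => F y ord0 i) x).
  apply: is_derive_sum => i; apply: is_deriveZ; exact: derivableP.
by apply: eq_bigr => i _; rewrite mxE.
Qed.

(** Projecting on [w = F b - F a] reduces to the scalar case with slope bound [enorm w * c]. Arguing
    coordinate by coordinate would lose a factor depending on [d], while the sharp constant is
    required. *)
Lemma vlip_derive_le F c : vlip F -> 0 <= c ->
  {ae mu, forall x, derivable F x 1 -> enorm ('D_1 F x) <= c} ->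
  forall a b, enorm (F b - F a) <= c * `|b - a|.
Proof.
move=> lF c0 H.
suff main a b : a <= b -> enorm (F b - F a) <= c * (b - a).
  move=> a b; have /orP[ab|ba] := le_total a b.
    by rewrite ger0_norm ?subr_ge0//; exact: main.
  by rewrite enormB distrC ger0_norm ?subr_ge0//; exact: main.
move=> ab; pose w := F b - F a.
have lf : lip_bounded (fun x => dotv w (F x)).
  move=> N.
  have [L HL] := choice (fun i => lF i N).
  exists (\sum_(i < d) `|w ord0 i| * L i) => x y xN yN.
  rewrite /dotv -sumrB mulr_suml (le_trans (ler_norm_sum _ _ _))//.
  apply: ler_sum => i _; rewrite -mulrBr normrM -mulrA ler_wpM2l//.
  exact: HL.
have wc : 0 <= enorm w * c by rewrite mulr_ge0// enorm_ge0.
have := lip_bounded_derive_le lf wc _ ab.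
have -> : dotv w (F b) - dotv w (F a) = enorm w ^+ 2.
  rewrite enorm_sqr; transitivity (dotv w (F b + (-1) *: F a)).
    by rewrite dotvDr dotvZr mulN1r.
  by rewrite scaleN1r.
move=> K; have {K} : enorm w ^+ 2 <= enorm w * c * (b - a).
  apply: K; move: H (vlip_ae_derivable lF); apply: filterS2 => x Hx dx _.
  have [_ ->] := dotv_derive w dx.
  by rewrite (le_trans (dotv_le _ _))// ler_wpM2l ?enorm_ge0// Hx.
have [/eqP w0 _|w0] := boolP (enorm w == 0).
  by rewrite -/w w0 mulr_ge0// subr_ge0.
by rewrite expr2 -mulrA ler_pM2l// lt_neqAle eq_sym w0 enorm_ge0.
Qed.

End LocalLip.

(** * Null sets along characteristics *)

Section AE.
Context {R : realType}.
Notation mu := (@lebesgue_measure R).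
Notation mu2 := (@leb2 R).
Notation RR := (measurableTypeR R * measurableTypeR R)%type.

#[global] Instance leb2_ae_filter : Filter (almost_everywhere mu2).
Proof. exact: ae_filter_ringOfSetsType. Qed.

(** For each fixed time the exceptional slice is a translate of the null set on the line. *)
Lemma ae_lift (a : R) (P : R -> Prop) : {ae mu, forall x, P x} ->
  {ae mu2, forall p : R * R, P (a * p.1 + p.2)}.
Proof.
move=> [N [mN N0 PN]].
pose l (p : RR) : measurableTypeR R := a * p.1 + p.2.
have ml : measurable_fun setT l.
  apply: continuous_measurable2.
  have El : l = (fun q : R * R => a * q.1 + 1 * q.2 + 0).
    by apply/funext => q; rewrite /l mul1r addr0.
  rewrite El => p; have [dl _] := is_diff_affine a 1 0 p.
  exact: differentiable_continuous dl.
exists (l @^-1` N); split.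
- by rewrite -[_ @^-1` _]setTI; exact: ml.
- rewrite /leb2 /= /product_measure1 /=.
  rewrite (eq_integral (fun=> 0%E)) ?integral0// => t _ /=.
  rewrite -N0 -(lebesgue_measure_shift (a * t) mN); congr (mu _).
  by apply/seteqP; split => s /=; rewrite /xsection /= inE /l /= addrC.
- by move=> p /= Hp; apply: PN.
Qed.

(** Almost every time slice of a planar null set is null; one such time suffices, since translating
    its slice by [a * t] recovers the line. *)
Lemma ae_descend (a : R) (P : R -> Prop) :
  {ae mu2, forall p : R * R, P (a * p.1 + p.2)} -> {ae mu, forall x, P x}.
Proof.
move=> [A [mA A0 PA]].
have mx : measurable_fun setT (mu \o xsection A) by exact: measurable_fun_xsection.
have : ae_eq mu setT (mu \o xsection A) (cst 0%E).
  apply/ae_eq_integral_abs => //.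
  rewrite -[RHS]A0 /leb2 /= /product_measure1 /=.
  by apply: eq_integral => t _; rewrite gee0_abs.
move=> [Z [mZ Z0 HZ]].
have [t Zt] : exists t, ~ Z t.
  apply/not_existsP => H.
  have : (mu `[0%R, 1%R]%classic <= 0)%E.
    rewrite -Z0; apply: le_measure; rewrite ?inE//= => x _.
    by apply: contrapT; exact: H.
  by rewrite lebesgue_measure_itv /= lte_fin ltr01 -EFinB lee_fin; lra.
have At0 : mu (xsection A t) = 0%E.
  by apply: contrapT => H; apply: Zt; apply: HZ => /= /(_ I).
have : mu.-negligible (xsection A t).
  by exists (xsection A t); split => //; exact: measurable_xsection.
move=> /(@negligible_shift R (- (a * t))); apply: negligibleS => x /= Px.
by rewrite /xsection /= inE; apply: PA => /=; rewrite addrC subrK.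
Qed.
End AE.

(** * Constraints in characteristic coordinates *)

Section Characteristic.
Context {R : realType} {d : nat}.
Variable k : R.
Hypothesis k0 : 0 < k.
Hypothesis k1 : k < 1.
Notation mu := (@lebesgue_measure R).
Notation mu2 := (@leb2 R).
Implicit Types (X : R * R -> 'rV[R]_d) (F G : R -> 'rV[R]_d) (p q v : R * R).

Definition speed : R := Num.sqrt (1 - k ^+ 2) / (2 * k).

Lemma speed_gt0 : 0 < speed.
Proof.
rewrite divr_gt0 ?mulr_gt0// sqrtr_gt0 subr_gt0.
by rewrite exprn_ilt1 ?ltW.
Qed.

Lemma speed_sqr : 4 * k ^+ 2 * speed ^+ 2 = 1 - k ^+ 2.
Proof.
have H : 0 <= 1 - k ^+ 2 by rewrite subr_ge0 exprn_ile1// ltW.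
rewrite /speed expr_div_n sqr_sqrtr//; field; rewrite gt_eqF//.
Qed.

(** With [u] and [v] standing for F' and G', the left side is 2 k^2 (|u|^2 + |v|^2 + ||u|^2 -
    |v|^2|), that is, 4 k^2 times the larger of |u|^2 and |v|^2. *)
Lemma relaxed_speed (u v : 'rV[R]_d) :
  (enorm (k *: (u - v)) ^+ 2 + k ^+ 2 * enorm (u + v) ^+ 2 +
    2 * k * `|dotv (k *: (u - v)) (u + v)| <= 1 - k ^+ 2) <->
  enorm u <= speed /\ enorm v <= speed.
Proof.
have sq (w : 'rV[R]_d) : (enorm w <= speed) = (enorm w ^+ 2 <= speed ^+ 2).
  by rewrite ler_pXn2r ?nnegrE ?enorm_ge0 ?(ltW speed_gt0).
rewrite !sq !enorm_sqr -speed_sqr -scaleN1r.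
rewrite !dotvDl !dotvDr !dotvZl !dotvZr !dotvDl !dotvDr !dotvZl !dotvZr (dotvC v u).
set a := dotv u u; set b := dotv v v; set e := dotv u v.
have -> : k * (a + -1 * e) + k * (e + -1 * b) = k * (a - b) by ring.
rewrite normrM (gtr0_norm k0).
have kk : 0 < k ^+ 2 by rewrite exprn_gt0.
have E (x : R) : (x <= speed ^+ 2) = (4 * k ^+ 2 * x <= 4 * k ^+ 2 * speed ^+ 2).
  by rewrite ler_pM2l// mulr_gt0.
rewrite !E.
have [h|h] := lerP 0 (a - b).
  rewrite ger0_norm//; split => [H|[H1 H2]].
    have H1 : 4 * k ^+ 2 * a <= 4 * k ^+ 2 * speed ^+ 2.
      by apply: le_trans H; rewrite le_eqVlt; apply/orP; left; apply/eqP; ring.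
    split => //; apply: le_trans H1; rewrite ler_pM2l ?mulr_gt0//; lra.
  by apply: le_trans H1; rewrite le_eqVlt; apply/orP; left; apply/eqP; ring.
rewrite ltr0_norm//; split => [H|[H1 H2]].
  have H1 : 4 * k ^+ 2 * b <= 4 * k ^+ 2 * speed ^+ 2.
    by apply: le_trans H; rewrite le_eqVlt; apply/orP; left; apply/eqP; ring.
  split => //; apply: le_trans H1; rewrite ler_pM2l ?mulr_gt0//; lra.
by apply: le_trans H2; rewrite le_eqVlt; apply/orP; left; apply/eqP; ring.
Qed.

(** Orthogonality says |u| = |v|, and the energy identity then fixes the common value. *)
Lemma initial_speed (u v : 'rV[R]_d) :
  (k * dotv (k *: (u - v)) (u + v) = 0 /\
   enorm (k *: (u - v)) ^+ 2 + k ^+ 2 * enorm (u + v) ^+ 2 = 1 - k ^+ 2) <->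
  enorm u = speed /\ enorm v = speed.
Proof.
have sq (w : 'rV[R]_d) : (enorm w = speed) <-> (enorm w ^+ 2 = speed ^+ 2).
  split => [->//|/eqP]; rewrite eqrXn2 ?enorm_ge0 ?(ltW speed_gt0)//.
  by move/eqP.
rewrite !sq !enorm_sqr -speed_sqr -scaleN1r.
rewrite !dotvDl !dotvDr !dotvZl !dotvZr !dotvDl !dotvDr !dotvZl !dotvZr (dotvC v u).
set a := dotv u u; set b := dotv v v; set e := dotv u v.
have kk : k ^+ 2 != 0 by rewrite expf_neq0// gt_eqF.
split => [[H1 H2]|[H1 H2]]; last by rewrite H1 H2; split; ring.
have ab : a = b.
  apply/eqP; rewrite -subr_eq0; apply/eqP/(mulfI kk); rewrite mulr0 -H1; ring.
have : a = speed ^+ 2.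
  apply: (mulfI (_ : 4 * k ^+ 2 != 0)); first by rewrite mulf_neq0.
  rewrite -H2 ab; ring.
by rewrite -ab.
Qed.

Lemma comp_char (a : R) F p (F' : 'rV[R]_d) v : is_derive (a * p.1 + p.2) 1 F F' ->
  is_derive p v (fun q => F (a * q.1 + q.2)) ((a * v.1 + v.2) *: F').
Proof.
have E : (fun q : R * R => F (a * q.1 + q.2)) = (fun q => F (a * q.1 + 1 * q.2 + 0)).
  by apply/funext => q; rewrite mul1r addr0.
rewrite E => H.
have H' : is_derive (a * p.1 + 1 * p.2 + 0) 1 F F' by rewrite mul1r addr0.
have [df Ef] := comp_affine H'.
by apply: DeriveDef; [exact: diff_derivable|rewrite Ef mul1r].
Qed.

Definition split_by X F G := forall p, X p = F (k * p.1 + p.2) + G (- k * p.1 + p.2).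

Lemma split_partials X F G p : split_by X F G ->
  derivable F (k * p.1 + p.2) 1 -> derivable G (- k * p.1 + p.2) 1 ->
  let u := 'D_1 F (k * p.1 + p.2) in let w := 'D_1 G (- k * p.1 + p.2) in
  [/\ has_partials X p, dt X p = k *: (u - w) & ds X p = u + w].
Proof.
move=> XE dF dG u w.
have -> : X = (fun q => F (k * q.1 + q.2)) + (fun q => G (- k * q.1 + q.2)) by apply/funext.
have D v := is_deriveD (comp_char v (derivableP dF)) (comp_char v (derivableP dG)).
have [d1 e1] := D (et R); have [d2 e2] := D (es R).
split; first by split; [exact: d1|exact: d2].
- by rewrite /dt e1 /= !mulr1 !addr0 scaleNr scalerBr.
- by rewrite /ds e2 /= !mulr0 !add0r !scale1r.
Qed.

Lemma pt_char p : pt k (k * p.1 + p.2) (- k * p.1 + p.2) = p.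
Proof. by case: p => t s; rewrite /pt /=; congr pair; [field; rewrite gt_eqF|field]. Qed.

Lemma char_pt (a b : R) : k * (pt k a b).1 + (pt k a b).2 = a /\ - k * (pt k a b).1 + (pt k a b).2 = b.
Proof. by rewrite /pt /=; split; field; rewrite gt_eqF. Qed.

Lemma pt00 : pt k 0 0 = (0, 0).
Proof. by rewrite /pt subrr addr0 !mul0r. Qed.

Definition lip (c : R) F := forall a b, enorm (F a - F b) <= c * `|a - b|.

Lemma lip_vlip (c : R) F : lip c F -> vlip F.
Proof.
move=> H i N; exists c => x y _ _; apply: le_trans (H x y).
by have := coord_le_enorm (F x - F y) i; rewrite !mxE.
Qed.

(* The form of the relaxed set that is visibly closed under pointwise limits. *)
Definition relaxed_char X :=
  [/\ X (0, 0) = 0,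
      forall a0 a1 b0 b1, X (pt k a1 b1) - X (pt k a1 b0) - X (pt k a0 b1) + X (pt k a0 b0) = 0,
      forall a0 a1 b, enorm (X (pt k a0 b) - X (pt k a1 b)) <= speed * `|a0 - a1| &
      forall a b0 b1, enorm (X (pt k a b0) - X (pt k a b1)) <= speed * `|b0 - b1|].

Lemma parallelogram_split X : X (0, 0) = 0 ->
  (forall a0 a1 b0 b1, X (pt k a1 b1) - X (pt k a1 b0) - X (pt k a0 b1) + X (pt k a0 b0) = 0) ->
  split_by X (fun a => X (pt k a 0)) (fun b => X (pt k 0 b)).
Proof.
move=> X0 H p; have := H 0 (k * p.1 + p.2) 0 (- k * p.1 + p.2).
by rewrite pt_char pt00 X0 addr0 => /eqP; rewrite subr_eq0 subr_eq addrC => /eqP.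
Qed.

Lemma split_relaxed X F G : F 0 = 0 -> G 0 = 0 -> lip speed F -> lip speed G ->
  split_by X F G -> relaxed_char X.
Proof.
move=> F0 G0 lF lG XE.
have E a b : X (pt k a b) = F a + G b by rewrite XE; have [-> ->] := char_pt a b.
split.
- by rewrite -pt00 E F0 G0 addr0.
- move=> a0 a1 b0 b1; rewrite !E; apply/rowP => i; rewrite !mxE; ring.
- by move=> a0 a1 b; rewrite !E opprD addrACA subrr addr0.
- by move=> a b0 b1; rewrite !E opprD addrACA subrr add0r.
Qed.

Lemma relaxed_split X : relaxed_char X -> exists F G,
  [/\ F 0 = 0, G 0 = 0, lip speed F, lip speed G & split_by X F G].
Proof.
move=> [X0 HX HF HG]; exists (fun a => X (pt k a 0)), (fun b => X (pt k 0 b)).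
by split; rewrite ?pt00//; [exact: parallelogram_split].
Qed.

(** Each characteristic coordinate changes by at most twice the maximum norm of [p - q], because
    [k < 1], and there are two curves. *)
Lemma relaxed_lip X p q : relaxed_char X ->
  `|X p - X q| <= 4 * speed * `|p - q|.
Proof.
move=> /relaxed_split [F [G [_ _ lF lG XE]]].
rewrite (le_trans (norm_le_enorm _))// !XE.
rewrite opprD addrACA (le_trans (enormD _ _))//.
have c0 := speed_gt0.
have n1 : `|p.1 - q.1| <= `|p - q|.
  by rewrite [leRHS]/Num.Def.normr /= le_max lexx.
have n2 : `|p.2 - q.2| <= `|p - q|.
  by rewrite [leRHS]/Num.Def.normr /= le_max lexx orbT.
have B (a : R) : `|a| <= 1 -> `|a * p.1 + p.2 - (a * q.1 + q.2)| <= 2 * `|p - q|.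
  move=> a1; rewrite opprD addrACA -mulrBr (le_trans (ler_normD _ _))// normrM.
  have : `|a| * `|p.1 - q.1| <= `|p - q| by rewrite (le_trans _ n1)// ler_piMl.
  lra.
have k1' : `|k| <= 1 by rewrite gtr0_norm// ltW.
have k1'' : `|- k| <= 1 by rewrite normrN.
rewrite (le_trans (lerD (lF _ _) (lG _ _)))//.
by have := ler_wpM2l (ltW c0) (B _ k1'); have := ler_wpM2l (ltW c0) (B _ k1''); lra.
Qed.

Lemma relaxed_locally_lipschitz X : relaxed_char X -> locally_lipschitz X.
Proof.
move=> XK p; exists setT; first exact: filterT.
exists (4 * speed); split; first exact: num_real.
move=> M cM [x y] _ /=; rewrite (le_trans (relaxed_lip _ _ XK))//.
by rewrite ler_wpM2r// ltW.
Qed.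

Lemma relaxed_continuous X : relaxed_char X -> continuous X.
Proof.
move=> XK p; apply/cvgrPdist_lt => e e0.
have c0 : 0 < 4 * speed by rewrite mulr_gt0// speed_gt0.
near=> q.
rewrite (le_lt_trans (relaxed_lip _ _ XK))// mulrC -ltr_pdivlMr//.
by near: q; apply: cvgr_dist_lt; [exact: cvg_id|exact: divr_gt0].
Unshelve. all: by end_near. Qed.

Lemma coord_cont X i : continuous X -> continuous (fun p => X p ord0 i).
Proof.
by move=> cX p; apply: (@continuous_comp _ _ _ X (fun u : 'rV[R]_d => u ord0 i) p (cX p));
  exact: coord_continuous.
Qed.

Lemma split_wave X F G : continuous X -> split_by X F G -> wave_equation k X.
Proof.
move=> cX XE phi i tphi; apply: parallelogram_wave => //.
  exact: coord_cont.
move=> [t s] h.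
(* A time step [h] changes the characteristic coordinates by [k * h] and [- (k * h)], a space step
   [k * h] changes both by [k * h]: the values of F match directly, those of G after a swap. *)
have H : X ((t, s) + h *: @et R) + X ((t, s) - h *: @et R) =
    X ((t, s) + (k * h) *: @es R) + X ((t, s) - (k * h) *: @es R).
  rewrite !XE addrACA [RHS]addrACA; congr (_ + _).
    by congr (F _ + F _); rewrite /et /es /= !scalerE; ring.
  by rewrite [RHS]addrC; congr (G _ + G _); rewrite /et /es /= !scalerE; ring.
by have := congr1 (fun u : 'rV[R]_d => u ord0 i) H; rewrite !mxE.
Qed.

Lemma dotvBr (u v w : 'rV[R]_d) : dotv u (v - w) = dotv u v - dotv u w.
Proof. by rewrite -[v - w]/(v + - w) -(scaleN1r w) dotvDr dotvZr mulN1r. Qed.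

Lemma derive_le (f : R -> R) (c x : R) : (forall a b, `|f a - f b| <= c * `|a - b|) ->
  derivable f x 1 -> 'D_1 f x <= c.
Proof.
move=> lf df; apply: limr_le => //; near=> h.
have h0 : h != 0 by near: h; exact: nbhs_dnbhs_neq.
rewrite (le_trans (ler_norm _))// scalerE normrM normfV ler_pdivrMl ?normr_gt0//.
by rewrite mulrC (le_trans (lf _ _))//= addrK scalerE mulr1.
Unshelve. all: by end_near. Qed.

(** The curve is projected on its own derivative [w], and [enorm w] is cancelled. *)
Lemma lip_derive c F x : lip c F -> derivable F x 1 -> enorm ('D_1 F x) <= c.
Proof.
move=> lF dF; have c0 : 0 <= c.
  by have := le_trans (enorm_ge0 _) (lF 0 1); rewrite sub0r normrN normr1 mulr1.
set w := 'D_1 F x; have [d1 d2] := dotv_derive w dF.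
have : dotv w w <= enorm w * c.
  rewrite -{2}/w -d2; apply: derive_le d1 => a b.
  have -> : dotv w (F a) - dotv w (F b) = dotv w (F a - F b).
    by rewrite dotvBr.
  rewrite -mulrA ler_norml; apply/andP; split.
    rewrite lerNl dotvBr opprB -dotvBr (le_trans (dotv_le _ _))//.
    by rewrite ler_wpM2l ?enorm_ge0// enormB.
  by rewrite (le_trans (dotv_le _ _))// ler_wpM2l ?enorm_ge0.
have [/eqP ->//|w0] := boolP (enorm w == 0).
by rewrite -enorm_sqr expr2 ler_pM2l// lt_neqAle eq_sym w0 enorm_ge0.
Qed.

Lemma split_relaxed_constraint X F G : lip speed F -> lip speed G -> split_by X F G ->
  relaxed_constraint k X.
Proof.
move=> lF lG XE.
have D H (c : R) : lip speed H -> {ae mu2, forall p : R * R, derivable H (c * p.1 + p.2) 1}.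
  by move=> lH; exact: (@ae_lift R c (fun x => derivable H x 1) (vlip_ae_derivable (lip_vlip lH))).
move: (D F k lF) (D G (- k) lG); apply: filterS2 => p dF dG.
have [hp -> ->] := split_partials XE dF dG; split => //.
by apply/relaxed_speed; split; apply: lip_derive.
Qed.

Lemma segment_lip X v : locally_lipschitz X -> continuous X -> forall N : R,
  exists L, forall x y : R, `|x| <= N -> `|y| <= N ->
    `|X (x *: v) - X (y *: v)| <= L * `|x - y|.
Proof.
move=> lX cX N.
pose V := `|v| + 1.
have V0 : 0 < V by rewrite ltr_pwDr.
have cK : compact `[- N, N]%classic by exact: segment_compact.
(* A single integer encodes both a radius and a Lipschitz constant, so that compactness of the
   segment yields a uniform choice. *)
pose P (n : nat) (x : R) := forall y : R, `|x - y| < n.+1%:R^-1 ->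
  `|X (x *: v) - X (y *: v)| <= n%:R * `|x *: v - y *: v|.
have [n HP] : exists n, `[- N, N]%classic `<=` P n.
  apply: (@filter_ex _ \oo%classic).
  have nc := (compact_near_coveringP _).1 cK; apply: (nc nat \oo%classic P) => x _.
  have [U /nbhs_ballP [e /= e0 eU] [M [_ HM]]] := lX (x *: v).
  (* Both [x'], within [r] of [x], and [y], within [r] of [x'], must give points in the ball of
     radius [e]. *)
  pose r := e / (2 * V).
  have r0 : 0 < r by rewrite divr_gt0 ?mulr_gt0.
  exists ([set x' : R | `|x - x'| < r], [set n : nat | n.+1%:R^-1 < r /\ M < n%:R]).
    split => /=.
      by apply/nbhs_ballP; exists r.
    near=> n; split; near: n; first by exact: near_infty_natSinv_lt (PosNum r0).
    exact: nbhs_infty_gtr.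
  move=> [x' n] [/= hx [hn hM]] y hy.
  have scl (z z' : R) : `|z *: v - z' *: v| <= `|z - z'| * V.
    by rewrite -scalerBl normrZ ler_wpM2l// lerDl.
  have Ux : U (x' *: v).
    apply: eU; rewrite -ball_normE /=; apply: (le_lt_trans (scl _ _)).
    rewrite -ltr_pdivlMr//; apply: (lt_le_trans hx); rewrite /r.
    by rewrite ler_pdivrMr ?mulr_gt0// mulrCA divfK ?gt_eqF//; lra.
  have Uy : U (y *: v).
    apply: eU; rewrite -ball_normE /=; apply: (le_lt_trans (scl _ _)).
    rewrite -ltr_pdivlMr//; apply: (le_lt_trans (ler_distD x' _ _)).
    have -> : e / V = r + r by rewrite /r; field; rewrite gt_eqF.
    by rewrite ltrD// (lt_trans hy).
  exact: (HM _ hM (x' *: v, y *: v) (conj Ux Uy)).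
have cXv : continuous (fun x : R => X (x *: v)).
  move=> x; apply: (@continuous_comp _ _ _ (fun x : R => x *: v) X); last exact: cX.
  by apply: cvgZr_tmp; exact: cvg_id.
have /compact_bounded [B [_ HB]] : compact ((fun x : R => X (x *: v)) @` `[- N, N]%classic).
  by apply: continuous_compact cK; exact: continuous_subspaceT.
pose C := `|B| + 1.
have HC (x : R) : `|x| <= N -> `|X (x *: v)| <= C.
  move=> xN; apply: (HB C); first by rewrite /C (le_lt_trans (ler_norm B))// ltrDl.
  by exists x => //=; rewrite in_itv /= -ler_norml.
have C0 : 0 <= C by rewrite addr_ge0.
(* The first summand serves points closer than [n.+1%:R^-1]; for the others the oscillation [2 * C]
   is at most [2 * C * n.+1%:R] times their distance. *)
exists (n%:R * `|v| + 2 * C * n.+1%:R) => x y xN yN.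
have xK : `[- N, N]%classic x by rewrite /= in_itv /= -ler_norml.
have [xy|xy] := ltP `|x - y| n.+1%:R^-1.
  rewrite (le_trans (HP x xK y xy))// -scalerBl normrZ mulrDl mulrA mulrAC.
  by rewrite lerDl !mulr_ge0.
rewrite (le_trans (ler_normB _ _))// (le_trans (lerD (HC x xN) (HC y yN)))//.
rewrite mulrDl -[leLHS]add0r lerD ?mulr_ge0//.
have : 1 <= n.+1%:R * `|x - y| by rewrite -ler_pdivrMl// mulr1.
move=> /(ler_wpM2l (_ : 0 <= 2 * C)); rewrite mulr1 mulrA => H.
by apply: le_trans (H _); [lra|rewrite mulr_ge0].
Unshelve. all: by end_near. Qed.

Lemma wave_split X : locally_lipschitz X -> continuous X -> X (0, 0) = 0 ->
  wave_equation k X -> exists F G, [/\ F 0 = 0, G 0 = 0, vlip F, vlip G & split_by X F G].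
Proof.
move=> lX cX X0 wX; exists (fun a => X (pt k a 0)), (fun b => X (pt k 0 b)).
have L (v : R * R) : vlip (fun a : R => X (a *: v)).
  move=> i N; have [L HL] := segment_lip v lX cX N; exists L => x y xN yN.
  apply: le_trans (HL x y xN yN).
  by have := coord_le_norm (X (x *: v) - X (y *: v)) i; rewrite !mxE.
split; rewrite ?pt00//.
- have -> : (fun a => X (pt k a 0)) = (fun a => X (a *: ((2 * k)^-1, 2^-1))).
    by apply/funext => a; rewrite /pt subr0 addr0.
  exact: L.
- have -> : (fun b => X (pt k 0 b)) = (fun b => X (b *: (- (2 * k)^-1, 2^-1))).
    by apply/funext => b; rewrite /pt sub0r add0r; congr (X (_, _)); rewrite mulNr -mulrN.
  exact: L.
- apply: parallelogram_split => // a0 a1 b0 b1; apply/rowP => i.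
  have cXi := @coord_cont X i cX.
  have := wave_parallelogram a0 a1 b0 b1 k0 k1 cXi (fun f tf => wX f i tf).
  by rewrite !mxE.
Qed.

Lemma split_lip X F G : split_by X F G -> F 0 = 0 -> G 0 = 0 ->
  {ae mu, forall x, derivable F x 1 -> enorm ('D_1 F x) <= speed} ->
  {ae mu, forall x, derivable G x 1 -> enorm ('D_1 G x) <= speed} ->
  vlip F -> vlip G -> relaxed_char X.
Proof.
move=> XE F0 G0 HF HG lF lG; have c0 := ltW speed_gt0.
by apply: split_relaxed XE => // a b; apply: vlip_derive_le.
Qed.

(** Each of the two derivative bounds depends on one characteristic coordinate only, so it descends
    from almost every point of the plane to almost every point of the line. *)
Lemma relaxed_constraint_char X : locally_lipschitz X -> continuous X -> X (0, 0) = 0 ->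
  wave_equation k X -> relaxed_constraint k X -> relaxed_char X.
Proof.
move=> lX cX X0 wX rX; have [F [G [F0 G0 lF lG XE]]] := wave_split lX cX X0 wX.
have AF : {ae mu2, forall p : R * R, derivable F (k * p.1 + p.2) 1}.
  exact: (@ae_lift R k (fun x => derivable F x 1) (vlip_ae_derivable lF)).
have AG : {ae mu2, forall p : R * R, derivable G (- k * p.1 + p.2) 1}.
  exact: (@ae_lift R (- k) (fun x => derivable G x 1) (vlip_ae_derivable lG)).
have H : {ae mu2, forall p : R * R, enorm ('D_1 F (k * p.1 + p.2)) <= speed /\
    enorm ('D_1 G (- k * p.1 + p.2)) <= speed}.
  move: AF AG rX; apply: filterS3 => p dF dG [_].
  have [_ -> ->] := split_partials XE dF dG.
  by move/relaxed_speed.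
apply: split_lip lF lG => //.
- apply: (@ae_descend R k (fun x => derivable F x 1 -> enorm ('D_1 F x) <= speed)).
  by move: H; apply: filterS => p [].
- apply: (@ae_descend R (- k) (fun x => derivable G x 1 -> enorm ('D_1 G x) <= speed)).
  by move: H; apply: filterS => p [].
Qed.

(** At time 0 both characteristic coordinates equal [s], so the initial constraints already govern F
    and G on the whole line. *)
Lemma initial_constraints_char X : locally_lipschitz X -> continuous X -> X (0, 0) = 0 ->
  wave_equation k X -> initial_constraints k X -> relaxed_char X.
Proof.
move=> lX cX X0 wX rX; have [F [G [F0 G0 lF lG XE]]] := wave_split lX cX X0 wX.
have H : {ae mu, forall x : R, enorm ('D_1 F x) = speed /\ enorm ('D_1 G x) = speed}.
  move: (vlip_ae_derivable lF) (vlip_ae_derivable lG) rX; apply: filterS3 => x dF dG [_].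
  have e0 (c : R) : c * (0 : R, x).1 + (0 : R, x).2 = x by rewrite /= mulr0 add0r.
  have := @split_partials X F G (0, x) XE; rewrite !e0 => /(_ dF dG) [_ -> ->].
  by move=> H1 H2; exact/initial_speed.
apply: split_lip lF lG => //.
- by move: H; apply: filterS => p [-> _].
- by move: H; apply: filterS => p [_ ->].
Qed.

Lemma split_initial X F G : split_by X F G ->
  {ae mu, forall x, derivable F x 1 /\ enorm ('D_1 F x) = speed} ->
  {ae mu, forall x, derivable G x 1 /\ enorm ('D_1 G x) = speed} ->
  initial_constraints k X.
Proof.
move=> XE; apply: filterS2 => x [dF eF] [dG eG].
have e0 (c : R) : c * (0 : R, x).1 + (0 : R, x).2 = x by rewrite /= mulr0 add0r.
have := @split_partials X F G (0, x) XE; rewrite !e0 => /(_ dF dG) [hp -> ->].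
by have [H1 H2] := (initial_speed ('D_1 F x) ('D_1 G x)).2 (conj eF eG).
Qed.

End Characteristic.

(** * Zigzag approximation *)

Section Zigzag.
Context {R : realType} {d : nat}.
Hypothesis hd : (1 <= d)%N.
Variables (c del : R) (F : R -> 'rV[R]_d).
Hypothesis c0 : 0 < c.
Hypothesis del0 : 0 < del.
Hypothesis lF : lip c F.
Notation mu := (@lebesgue_measure R).
Implicit Types (x y r : R) (m n : int).

(* At v = 0 this is an arbitrary unit vector: a constant stretch of F is
   replaced by a back-and-forth motion in any direction. *)
Definition unitv (v : 'rV[R]_d) : 'rV[R]_d :=
  let w := if v == 0 then const_mx 1 else v in (enorm w)^-1 *: w.

Lemma enorm_unitv v : enorm (unitv v) = 1.
Proof.
rewrite /unitv; set w := if _ then _ else _.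
have w0 : w != 0.
  rewrite /w; case: ifPn => // _; apply/eqP => /rowP /(_ (Ordinal hd)).
  by rewrite !mxE => /eqP; rewrite oner_eq0.
have e0 : enorm w != 0 by apply: contra w0 => /eqP /enorm_eq0 ->.
by rewrite enormZ normfV ger0_norm ?enorm_ge0// mulVf.
Qed.

Lemma unitvE v : v = enorm v *: unitv v.
Proof.
rewrite /unitv; have [->|v0] := eqVneq v 0; first by rewrite enorm0 scale0r.
rewrite scalerA divff ?scale1r//.
by apply: contra v0 => /eqP /enorm_eq0 ->.
Qed.

Definition node m : R := m%:~R * del.
Definition jump m := F (node (m + 1)) - F (node m).
(* Going out at speed c up to this time and back afterwards covers the distance
   enorm (jump m) within the time del. *)
Definition turn m : R := (del + enorm (jump m) / c) / 2.
(** A tent with slopes 1 and -1 and peak at [turn m]; its value at [del] is [enorm (jump m) / c]. *)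
Definition tri m r : R := Num.min r (2 * turn m - r).
Definition piece m x := F (node m) + (c * tri m (x - node m)) *: unitv (jump m).
Definition zigzag x := piece (Num.floor (x / del)) x.

Lemma nodeS m : node (m + 1) = node m + del.
Proof. by rewrite /node intrD mulrDl mul1r. Qed.

Lemma node_floor x : node (Num.floor (x / del)) <= x < node (Num.floor (x / del) + 1).
Proof.
by rewrite /node -ler_pdivlMr// -ltr_pdivrMr// Num.Theory.floor_itv.
Qed.

Lemma floor_node m x : node m <= x < node (m + 1) -> Num.floor (x / del) = m.
Proof.
rewrite /node -ler_pdivlMr// -ltr_pdivrMr// => H.
exact: Num.Theory.floor_def.
Qed.

Lemma jump_le m : enorm (jump m) / c <= del.
Proof.
rewrite ler_pdivrMr// mulrC (le_trans (lF _ _))// nodeS addrAC subrr add0r.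
by rewrite gtr0_norm.
Qed.

Lemma tri_lip m r r' : `|tri m r - tri m r'| <= `|r - r'|.
Proof.
have h1 := ler_norm (r - r'); have h2 := ler_norm (r' - r); rewrite distrC in h2.
rewrite /tri; case: (leP r (2 * turn m - r)) => ?; case: (leP r' (2 * turn m - r')) => ?;
 rewrite ler_norml; lra.
Qed.

Lemma piece_lip m : lip c (piece m).
Proof.
move=> x y; rewrite /piece opprD addrACA subrr add0r -scalerBl -mulrBr.
rewrite enormZ enorm_unitv mulr1 normrM (gtr0_norm c0); apply: ler_wpM2l; first exact: ltW.
have := tri_lip m (x - node m) (y - node m).
by rewrite opprD addrACA subrr addr0.
Qed.

Lemma piece_left m : piece m (node m) = F (node m).
Proof.
rewrite /piece subrr /tri subr0 min_l ?mulr0 ?scale0r ?addr0//.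
have := divr_ge0 (enorm_ge0 (jump m)) (ltW c0).
by move: (del0); rewrite /turn; lra.
Qed.

Lemma piece_right m : piece m (node (m + 1)) = F (node (m + 1)).
Proof.
rewrite /piece nodeS addrAC subrr add0r /tri min_r; last first.
  by have := jump_le m; rewrite /turn; lra.
have -> : c * (2 * turn m - del) = enorm (jump m).
  by rewrite /turn; field; rewrite gt_eqF.
by rewrite -unitvE /jump addrC subrK nodeS.
Qed.

(** At the right end the floor already selects the next piece; both pieces take the value of [F]
    there. *)
Lemma zigzag_piece m x : node m <= x <= node (m + 1) -> zigzag x = piece m x.
Proof.
move=> /andP[mx]; rewrite le_eqVlt => /predU1P[->|xm].
  have E : Num.floor (node (m + 1) / del) = m + 1.
    by apply: floor_node; rewrite lexx [X in _ < X]nodeS ltrDl.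
  by rewrite /zigzag E piece_left piece_right.
by rewrite /zigzag (floor_node (m := m)) ?mx.
Qed.

Lemma zigzag_node m : zigzag (node m) = F (node m).
Proof. by rewrite (@zigzag_piece m) ?piece_left// lexx nodeS lerDl ltW. Qed.

Lemma node_le m n : m <= n -> node m <= node n.
Proof. by move=> mn; rewrite ler_pM2r// ler_int. Qed.

(** For points in different cells the path is broken at the node after [x] and the node before [y].
    Between these nodes the Lipschitz bound of [F] itself is used, however many cells lie in
    between. *)
Lemma zigzag_lip : lip c zigzag.
Proof.
suff main x y : x <= y -> enorm (zigzag x - zigzag y) <= c * (y - x).
  move=> x y; have /orP[xy|yx] := le_total x y.
    by rewrite distrC ger0_norm ?subr_ge0//; exact: main.
  by rewrite enormB ger0_norm ?subr_ge0//; exact: main.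
move=> xy; set m := Num.floor (x / del); set n := Num.floor (y / del).
have /andP[mx xm] := node_floor x; have /andP[ny yn] := node_floor y.
rewrite -/m -/n in mx xm ny yn.
have Zx : zigzag x = piece m x by [].
have Zy : zigzag y = piece n y by [].
have [mn|mn] := eqVneq m n.
  by rewrite Zx Zy -mn (le_trans (piece_lip _ _ _))// distrC ger0_norm// subr_ge0.
have mn1 : m + 1 <= n.
  by rewrite lezD1 lt_neqAle mn; apply: Num.Theory.le_floor; rewrite ler_pM2r ?invr_gt0.
have nn := node_le mn1.
rewrite (le_trans (enorm_triangle _ (F (node (m + 1))) _))//.
rewrite (le_trans (lerD (lexx _) (enorm_triangle _ (F (node n)) _)))//.
have A1 : enorm (zigzag x - F (node (m + 1))) <= c * (node (m + 1) - x).
  rewrite Zx -piece_right (le_trans (piece_lip _ _ _))// distrC ger0_norm// subr_ge0 ltW//.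
have A2 : enorm (F (node (m + 1)) - F (node n)) <= c * (node n - node (m + 1)).
  by rewrite (le_trans (lF _ _))// distrC ger0_norm// subr_ge0.
have A3 : enorm (F (node n) - zigzag y) <= c * (y - node n).
  by rewrite Zy -piece_left (le_trans (piece_lip _ _ _))// distrC ger0_norm// subr_ge0.
by lra.
Qed.

Lemma zigzag_approx x : enorm (zigzag x - F x) <= 2 * c * del.
Proof.
set m := Num.floor (x / del).
have /andP[mx xm] := node_floor x; rewrite -/m nodeS in mx xm.
have E : `|x - node m| <= del by rewrite ger0_norm; lra.
rewrite (le_trans (enorm_triangle _ (F (node m)) _))//.
have A1 : enorm (zigzag x - F (node m)) <= c * del.
  by rewrite -zigzag_node (le_trans (zigzag_lip _ _))// ler_wpM2l// ltW.
have A2 : enorm (F (node m) - F x) <= c * del.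
  by rewrite (le_trans (lF _ _))// distrC ler_wpM2l// ltW.
lra.
Qed.

Lemma is_derive_affine (b e : 'rV[R]_d) (a x : R) :
  is_derive x 1 (fun y : R => b + (a * y) *: e) (a *: e).
Proof.
have -> : (fun y : R => b + (a * y) *: e) = (cst b + (fun y : R => a *: (y *: e))).
  by apply/funext => y; rewrite !fctE scalerA.
rewrite -[X in is_derive _ _ _ X]add0r; apply: is_deriveD; apply: is_deriveZ.
have E : (fun h : R => h^-1 *: ((h *: (1 : R) + x) *: e - x *: e)) @ 0^' --> e.
  apply: cvg_near_cst; near=> h.
  have h0 : h != 0 by near: h; exact: nbhs_dnbhs_neq.
  by rewrite (_ : h *: (1 : R) = h) ?scalerDl ?addrK ?scalerA ?mulVf ?scale1r//; exact: mulr1.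
by apply: DeriveDef; [apply/cvg_ex; exists e | exact: cvg_lim E].
Unshelve. all: by end_near. Qed.

Lemma zigzag_derive x : (forall m, x != node m) -> (forall m, x != node m + turn m) ->
  derivable zigzag x 1 /\ enorm ('D_1 zigzag x) = c.
Proof.
move=> xn xt; set m := Num.floor (x / del).
have /andP[mx xm] := node_floor x; rewrite -/m in mx xm.
have {mx}mx : node m < x by rewrite lt_neqAle eq_sym xn.
(* Off the nodes and turning points the curve is locally affine: [s] is 1 before the turn and -1
   after it, and [b] collects the constant terms of [piece]. *)
suff [s [b [s1 N]]] : exists s b, `|s| = 1 /\
    \forall y \near x, b + (c * s * y) *: unitv (jump m) = zigzag y.
  have [h1 h2] := near_eq_is_derive N (is_derive_affine b (unitv (jump m)) (c * s) x).
  split; first exact: h1.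
  by rewrite h2 enormZ enorm_unitv mulr1 normrM s1 mulr1 gtr0_norm.
have near_in : \forall y \near x, node m < y /\ y < node (m + 1).
  near=> y; split; near: y; [exact: lt_nbhsr|exact: lt_nbhsl].
have [xl|xr] := ltP x (node m + turn m).
  exists 1, (F (node m) - (c * node m) *: unitv (jump m)); rewrite normr1; split => //.
  near=> y.
  have [y1 y2] : node m < y /\ y < node (m + 1) by near: y.
  have yl : y < node m + turn m by near: y; exact: lt_nbhsl.
  rewrite (@zigzag_piece m) ?(ltW y1) ?(ltW y2)// /piece /tri min_l; last by lra.
  by rewrite -addrA mulr1 mulrBr scalerBl addrC [RHS]addrC; congr (_ + _); rewrite addrC.
have {}xr : node m + turn m < x by rewrite lt_neqAle eq_sym xt.
exists (-1), (F (node m) + (c * (2 * turn m + node m)) *: unitv (jump m)); rewrite normrN1; split => //.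
near=> y.
have [y1 y2] : node m < y /\ y < node (m + 1) by near: y.
have yr : node m + turn m < y by near: y; exact: lt_nbhsr.
rewrite (@zigzag_piece m) ?(ltW y1) ?(ltW y2)// /piece /tri min_r; last by lra.
rewrite -addrA; congr (_ + _); rewrite -scalerDl; congr (_ *: _); ring.
Unshelve. all: by end_near. Qed.

Lemma zigzag_ae : {ae mu, forall x, derivable zigzag x 1 /\ enorm ('D_1 zigzag x) = c}.
Proof.
have N (f : int -> R) : {ae mu, forall x, forall m, x != f m}.
  have cf : countable (range f) by apply: (@sub_countable _ _ _ [set: int]) => //; exact: card_image_le.
  exists (range f); split.
  - exact: countable_measurable.
  - exact: countable_lebesgue_measure0.
  - move=> x /= H; apply: contrapT => H'; apply: H => m; apply/eqP => E; apply: H'.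
    by exists m.
move: (N node) (N (fun m => node m + turn m)); apply: filterS2 => x; exact: zigzag_derive.
Qed.

End Zigzag.

Lemma enorm_continuous (R : realType) (d : nat) : continuous (@enorm R d).
Proof.
move=> u; apply/(@cvgrPdist_lt _ _ _ (nbhs u) (nbhs_filter u)) => e e0.
have d0 : 0 < d%:R + 1 :> R by rewrite ltr_wpDl.
near=> v.
have uv : `|u - v| < e / (d%:R + 1).
  near: v; apply: cvgr_dist_lt; [exact: cvg_id|exact: divr_gt0].
have h : enorm (u - v) < e.
  rewrite (le_lt_trans (enorm_le_norm _))//.
  rewrite (@le_lt_trans _ _ ((d%:R + 1) * `|u - v|))//.
    by rewrite ler_wpM2r// lerDl.
  by rewrite mulrC -ltr_pdivlMr.
rewrite (le_lt_trans _ h)// ler_norml.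
have h1 := enorm_triangle u v 0; have h2 := enorm_triangle v u 0.
by move: h1 h2; rewrite !subr0 (enormB v u); lra.
Unshelve. all: by end_near. Qed.

(** * Compactness and density *)

Section RelaxedClosure.
Context {R : realType} {d : nat}.
Variable k : R.
Hypotheses (k0 : 0 < k) (k1 : k < 1).
Notation speed := (speed k).
Notation K := [set f : R * R -> 'rV[R]_d | relaxed_char k f].

Lemma relaxed_equicontinuous : equicontinuous K id.
Proof.
move=> p E; rewrite -entourage_ballE => -[e /= e0 eE].
have c0 : 0 < 4 * speed by rewrite mulr_gt0// speed_gt0.
near=> q => f Kf /=; apply: eE; rewrite /= -ball_normE /=.
rewrite (le_lt_trans (relaxed_lip k0 k1 p q Kf))// mulrC -ltr_pdivlMr//.
near: q; apply: cvgr_dist_lt; [exact: cvg_id|exact: divr_gt0].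
Unshelve. all: by end_near. Qed.

Lemma relaxed_pointwise_precompact : pointwise_precompact K id.
Proof.
move=> p; set M := 4 * speed * `|p|.
have cB : compact [set u : 'rV[R]_d | `|u| <= M].
  apply: bounded_closed_compact.
    exists M; split; first exact: num_real.
    by move=> N MN u /= uM; rewrite (le_trans uM)// ltW.
  apply: (@preimage_closed _ _ (fun u : 'rV[R]_d => `|u|) [set x | x <= M]).
    by move=> u _; exact: norm_continuous.
  exact: closed_le.
apply: precompact_subset (compact_precompact (@norm_hausdorff _ _) cB).
move=> _ [f Kf <-] /=; have [f0 _ _ _] := Kf.
by have := relaxed_lip k0 k1 p (0, 0) Kf; rewrite f0 subr0 [p - _]subr0.
Qed.

Lemma relaxed_closed_ptws : closed (K : set {ptws R * R -> 'rV[R]_d}).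
Proof.
move=> f; rewrite closureEcvg => -[G PG [Gf KG]].
have closed0 : closed [set u : 'rV[R]_d | u = 0].
  by apply: (accessible_closed_set1 (hausdorff_accessible (@norm_hausdorff _ 'rV[R]_d))).
have GK : \forall g \near G, K g by exact: KG.
have C p : (fun g : {ptws R * R -> 'rV[R]_d} => g p) @ G --> f p.
  exact: cvg_comp Gf (@proj_continuous _ _ p f).
have CE p q : (fun g : {ptws R * R -> 'rV[R]_d} => enorm (g p - g q)) @ G --> enorm (f p - f q).
  exact: (@cvg_comp _ _ _ (fun g : {ptws R * R -> 'rV[R]_d} => g p - g q) (@enorm R d) G _ _
    (cvgB (C p) (C q)) (@enorm_continuous R d _)).
have Z (u : {ptws R * R -> 'rV[R]_d} -> 'rV[R]_d) (l : 'rV[R]_d) : u @ G --> l ->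
    (forall g, K g -> u g = 0) -> l = 0.
  move=> ul H; have U : \forall g \near G, u g = 0 by apply: filterS GK; exact: H.
  exact: (closed_cvg _ closed0 U _ ul).
have L (u : {ptws R * R -> 'rV[R]_d} -> R) (l c : R) : u @ G --> l ->
    (forall g, K g -> u g <= c) -> l <= c.
  move=> ul H; have U : \forall g \near G, u g <= c by apply: filterS GK; exact: H.
  exact: (closed_cvg _ (@closed_le _ c) U _ ul).
split.
- by apply: (Z _ _ (C (0, 0))) => g [].
- move=> a0 a1 b0 b1; apply: (Z _ _
    (cvgD (cvgB (cvgB (C (pt k a1 b1)) (C (pt k a1 b0))) (C (pt k a0 b1))) (C (pt k a0 b0)))).
  by move=> g [_ + _ _]; apply.
- by move=> a0 a1 b; apply: (L _ _ _ (CE _ _)) => g [].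
- by move=> a b0 b1; apply: (L _ _ _ (CE _ _)) => g [].
Qed.

(** For an equicontinuous family, closures under pointwise and under locally uniform convergence
    coincide. *)
Lemma relaxed_closed_family : closed (K : set {family compact, R * R -> 'rV[R]_d}).
Proof.
rewrite closure_id (pointwise_compact_closure relaxed_equicontinuous).
by rewrite -(closure_id _).1//; exact: relaxed_closed_ptws.
Qed.

Lemma relaxed_compact_family : compact (K : set {family compact, R * R -> 'rV[R]_d}).
Proof.
rewrite -(precompact_closed relaxed_closed_family).
apply: pointwise_precompact_equicontinuous.
- exact: norm_hausdorff.
- exact: relaxed_pointwise_precompact.
- exact: relaxed_equicontinuous.
Qed.

(** * Transfer to the space of continuous maps *)

Definition relaxed_set : set (C0 R d) := [set X | relaxed_char k (C0_fun X)].

Lemma C0_fun_continuous (X : C0 R d) : continuous (C0_fun X).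
Proof. exact: cts_fun. Qed.

Lemma C0_exists (f : R * R -> 'rV[R]_d) : continuous f -> exists X : C0 R d, C0_fun X = f.
Proof.
move=> cf; pose X : continuousType (R * R)%type 'rV[R]_d := HB.pack f (isContinuous.Build _ _ f cf).
by exists (X : C0 R d).
Qed.

Lemma C0_nbhs (X : C0 R d) (B : set (C0 R d)) : nbhs X B ->
  exists2 B' : set {family compact, R * R -> 'rV[R]_d},
    nbhs (C0_fun X : {family compact, R * R -> 'rV[R]_d}) B' &
    forall Y : C0 R d, B' (C0_fun Y) -> B Y.
Proof.
move=> [_ [[B' oB' <-] XB'] sB]; exists B'; first exact: open_nbhs_nbhs.
by move=> Y BY; exact: sB.
Qed.

Lemma relaxed_set_closed : closed relaxed_set.
Proof.
apply: (@preimage_closed (C0 R d) {family compact, R * R -> 'rV[R]_d} (fun X => C0_fun X) K).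
  by move=> X _; exact: initial_continuous.
exact: relaxed_closed_family.
Qed.

Lemma relaxed_set_compact : compact relaxed_set.
Proof.
move=> F PF FK.
have [f [Kf cf]] := @relaxed_compact_family (fmap (fun X : C0 R d => C0_fun X) F) _ FK.
(* The cluster point is found among all maps; membership in [K] makes it continuous, hence a point
   of [C0]. *)
have [X Xf] := C0_exists (relaxed_continuous k0 k1 Kf).
exists X; split; first by rewrite /relaxed_set /= Xf.
move=> A B FA /C0_nbhs[B' XB' sB]; rewrite Xf in XB'.
have FA' : F [set Y | [set C0_fun Z | Z in A] (C0_fun Y)] by apply: filterS FA => Y AY; exists Y.
have [_ [[Y AY <-] BY]] := cf _ _ FA' XB'.
by exists Y; split => //; exact: sB.
Qed.

Lemma F_set_relaxed : F_set d k `<=` relaxed_set.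
Proof.
move=> X [lX X0 wX iX]; apply: initial_constraints_char => //.
exact: C0_fun_continuous.
Qed.

Lemma uniform_limit_closure (S : set (C0 R d)) (X : C0 R d) :
  (forall e : R, 0 < e -> exists2 Y, S Y & forall p, `|C0_fun X p - C0_fun Y p| < e) ->
  closure S X.
Proof.
move=> H B /C0_nbhs[B' XB' sB].
have /choice[Y HY] : forall n : nat, exists Y, S Y /\
    forall p, `|C0_fun X p - C0_fun Y p| < n.+1%:R^-1.
  by move=> n; have [|Y ? ?] := H n.+1%:R^-1; [rewrite invr_gt0|exists Y].
have cY : {family compact, (fun n => C0_fun (Y n)) @ \oo --> C0_fun X}.
  apply/fam_cvgP => A _ P /uniform_nbhs[E [entE sP]].
  move: entE; rewrite -entourage_ballE => -[e /= e0 eE].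
  near=> n; apply: sP => p _; apply: eE; rewrite /= -ball_normE /=.
  rewrite (lt_le_trans ((HY n).2 p))// ltW//.
  near: n; exact: near_infty_natSinv_lt (PosNum e0).
have /filter_ex[n Bn] : \forall n \near \oo, B' (C0_fun (Y n)) by exact: cY.
by exists (Y n); split; [exact: (HY n).1 | exact: sB].
Unshelve. all: by end_near. Qed.

Hypothesis hd : (1 <= d)%N.

Lemma relaxed_set_closure : relaxed_set `<=` closure (F_set d k).
Proof.
move=> X /(relaxed_split k0) [F [G [F0 G0 lF lG XE]]].
apply: uniform_limit_closure => e e0.
have c0 := speed_gt0 k0 k1.
(* Each curve contributes an error of at most [2 * speed * del], together 4/5 of [e], which leaves
   the inequality strict. *)
pose del := e / (5 * speed).
have del0 : 0 < del by rewrite divr_gt0// mulr_gt0.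
pose zF := zigzag speed del F; pose zG := zigzag speed del G.
(* The origin is a node of the grid, so the approximation keeps the normalization at (0, 0). *)
have z0 (H : R -> 'rV[R]_d) : lip speed H -> H 0 = 0 -> zigzag speed del H 0 = 0.
  move=> lH H0; have := zigzag_node c0 del0 lH 0.
  by rewrite /node mul0r H0.
pose Y p := zF (k * p.1 + p.2) + zG (- k * p.1 + p.2).
have lzF : lip speed zF by exact: zigzag_lip.
have lzG : lip speed zG by exact: zigzag_lip.
have YE : split_by k Y zF zG by [].
have rY : relaxed_char k Y.
  by apply: (split_relaxed k0 _ _ lzF lzG YE); exact: z0.
have cY := relaxed_continuous k0 k1 rY.
have [Z ZY] := C0_exists cY.
exists Z.
  rewrite /F_set /= ZY; split.
  - exact: relaxed_locally_lipschitz rY.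
  - by have [] := rY.
  - exact: split_wave cY YE.
  - by apply: (split_initial k0 k1 YE); exact: zigzag_ae.
move=> p; rewrite ZY XE /Y opprD addrACA.
rewrite (le_lt_trans (ler_normD _ _))//.
have A1 := le_trans (norm_le_enorm _) (zigzag_approx hd c0 del0 lF (k * p.1 + p.2)).
have A2 := le_trans (norm_le_enorm _) (zigzag_approx hd c0 del0 lG (- k * p.1 + p.2)).
rewrite distrC in A1; rewrite distrC in A2.
rewrite (le_lt_trans (lerD A1 A2))//.
have -> : 2 * speed * del + 2 * speed * del = 4 / 5 * e.
  by rewrite /del; field; rewrite gt_eqF.
lra.
Qed.

Lemma F_set_closure : closure (F_set d k) = relaxed_set.
Proof.
apply/seteqP; split; last exact: relaxed_set_closure.
rewrite [X in _ `<=` X](closure_id _).1; last exact: relaxed_set_closed.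
by apply: closureS; exact: F_set_relaxed.
Qed.

Lemma relaxed_setE : relaxed_set =
  [set X : C0 R d |
    [/\ locally_lipschitz (C0_fun X), C0_fun X (0, 0) = 0,
        wave_equation k (C0_fun X) & relaxed_constraint k (C0_fun X)]].
Proof.
apply/seteqP; split => X /=.
  move=> rX; have [F [G [F0 G0 lF lG XE]]] := relaxed_split k0 rX.
  split.
  - exact: relaxed_locally_lipschitz rX.
  - by have [] := rX.
  - apply: (split_wave k0 _ XE); exact: C0_fun_continuous.
  - exact: split_relaxed_constraint lF lG XE.
by move=> [lX X0 wX rX]; apply: relaxed_constraint_char => //; exact: C0_fun_continuous.
Qed.

End RelaxedClosure.

Theorem theorem1p1 (R : realType) (d : nat) (kappa : R)
    (hd : (1 <= d)%N) (kappa_gt0 : 0 < kappa) (kappa_lt1 : kappa < 1) :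
  precompact (F_set d kappa) /\
  closure (F_set d kappa) =
    [set X : C0 R d |
      [/\ locally_lipschitz (C0_fun X), C0_fun X (0, 0) = 0,
          wave_equation kappa (C0_fun X) &
          relaxed_constraint kappa (C0_fun X)]].
Proof.
rewrite precompactE F_set_closure// -relaxed_setE//; split => //.
exact: relaxed_set_compact.
Qed.
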